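(* Let $X$ be a Tychonoff space and $E=C_k(C_k(X))$. (i) If $X$ is metrizable, then $E$ has a $\mathfrak{G}$-base if and only if $X$ is $\sigma$-compact; in this case $E$ is barrelled. (ii) If $X$ is an $\aleph_0$-space, then the strong dual $E'_\beta$ of $E$ has a $\mathfrak{G}$-base if and only if $X$ is finite. In particular, if $X$ is infinite, then $E$ is not a regular $(LM)$-space. (iii) If $X$ is a $\mu$-space and $E'_\beta$ has a $\mathfrak{G}$-base, then $X$ has a fundamental compact resolution, so that $C_k(X)$ has a $\mathfrak{G}$-base. The converse is not true in general: there is a $\mu$-space $X$ with a fundamental compact resolution for which $E'_\beta$ has no $\mathfrak{G}$-base. Consequently, if $X$ is an infinite metrizable $\sigma$-compact space, then $E$ is a barrelled space with a $\mathfrak{G}$-base whose strong dual $E'_\beta$ does not have a $\mathfrak{G}$-base.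
   Context: $C_k(Y)$ denotes the space of continuous real-valued functions on a Tychonoff space $Y$ with the compact-open topology; $E'_\beta$ is the dual of $E$ with the topology of uniform convergence on bounded subsets of $E$. Order $\mathbb{N}^{\mathbb{N}}$ pointwise. A $\mathfrak{G}$-base is a base of neighbourhoods of zero $\{U_\alpha:\alpha\in\mathbb{N}^{\mathbb{N}}\}$ with $U_\alpha\subseteq U_\beta$ whenever $\beta\le\alpha$. A fundamental compact resolution of $X$ is a family $\{K_\alpha:\alpha\in\mathbb{N}^{\mathbb{N}}\}$ of compact sets covering $X$ with $K_\alpha\subseteq K_\beta$ for $\alpha\le\beta$ such that every compact subset of $X$ lies in some $K_\alpha$. An $\aleph_0$-space is a Tychonoff space which is the image of a separable metric space under a continuous compact-covering map (every compact subset of the image is the image of a compact set). A $\mu$-space is a Tychonoff space in which every functionally bounded subset (one on which every continuous real function is bounded) is relatively compact. An $(LM)$-space is the locally convex inductive limit of an increasing sequence of metrizable locally convex spaces $(E_n,\tau_n)$ with $\tau_{n+1}|_{E_n}\le\tau_n$; it is regular if every bounded set is contained and bounded in some $E_n$. *)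

(* Defs.v *)
From mathcomp Require Import all_boot all_order all_algebra.
From mathcomp Require Import all_classical all_reals all_analysis.
From mathcomp Require Import Rstruct Rstruct_topology.
Import Order.TTheory GRing.Theory Num.Theory.
Import numFieldNormedType.Exports.

Set Implicit Arguments.
Unset Strict Implicit.
Unset Printing Implicit Defensive.

Local Open Scope classical_set_scope.
Local Open Scope ring_scope.

Notation RR := Rdefinitions.R.

Definition tychonoff_space (X : topologicalType) : Prop :=
  hausdorff_space X /\
  forall (B : set X) (x : X), closed B -> ~ B x ->
    exists f : X -> RR, continuous f /\ f x = 0 /\ (forall y, B y -> f y = 1).

Definition metrizable (X : topologicalType) : Prop :=
  exists d : X -> X -> RR,
    (forall x y, 0 <= d x y) /\
    (forall x y, d x y = 0 <-> x = y) /\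
    (forall x y, d x y = d y x) /\
    (forall x y z, d x z <= d x y + d y z) /\
    (forall (x : X) (A : set X),
        nbhs x A <-> exists2 e : RR, 0 < e & [set y | d x y < e] `<=` A).

Definition separable_space (X : topologicalType) : Prop :=
  exists D : set X, countable D /\ closure D = setT.

Definition sigma_compact (X : topologicalType) : Prop :=
  exists K : nat -> set X, (forall n, compact (K n)) /\ \bigcup_n K n = setT.

Definition leNN (a b : nat -> nat) : Prop := forall i, (a i <= b i)%N.

Definition fundamental_compact_resolution (X : topologicalType)
    (K : (nat -> nat) -> set X) : Prop :=
  (forall a, compact (K a)) /\
  (\bigcup_a K a = setT) /\
  (forall a b, leNN a b -> K a `<=` K b) /\
  (forall C : set X, compact C -> exists a, C `<=` K a).

Definition has_fcr (X : topologicalType) : Prop :=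
  exists K : (nat -> nat) -> set X, fundamental_compact_resolution K.

Definition aleph0_space (X : topologicalType) : Prop :=
  tychonoff_space X /\
  exists (M : topologicalType) (f : M -> X),
    metrizable M /\ separable_space M /\ continuous f /\
    f @` setT = setT /\
    (forall K : set X, compact K -> exists2 C : set M, compact C & f @` C = K).

Definition functionally_bounded (X : topologicalType) (A : set X) : Prop :=
  forall f : X -> RR, continuous f -> exists M : RR, forall x, A x -> `|f x| <= M.

Definition mu_space (X : topologicalType) : Prop :=
  tychonoff_space X /\
  forall A : set X, functionally_bounded A -> compact (closure A).

Definition cont_funs (Y : topologicalType) : set {compact-open, Y -> RR} :=
  [set f | continuous (f : Y -> RR)].

Definition Ck (Y : topologicalType) : topologicalType := set_type (@cont_funs Y).

Definition Ck_val (Y : topologicalType) (f : Ck Y) : Y -> RR :=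
  (set_val f : Y -> RR).

Definition CkCk (X : topologicalType) : topologicalType := Ck (Ck X).
Definition CkCk_val (X : topologicalType) : CkCk X -> Ck X -> RR :=
  @Ck_val (Ck X).

(* Linear-topological notions for a space V of real functions on T,    *)
(* given through the (injective) evaluation map v : V -> T -> R; the   *)
(* vector operations are pointwise.                                    *)
Section FunctionSpace.
Context {T : Type} {V : topologicalType} (v : V -> T -> RR).

Definition is_comb (a : RR) (x : V) (b : RR) (y : V) (z : V) : Prop :=
  forall t, v z t = a * v x t + b * v y t.

Definition is_scaled (a : RR) (x z : V) : Prop := forall t, v z t = a * v x t.

Definition is_zero (z : V) : Prop := forall t, v z t = 0.

Definition nbhs0 (A : set V) : Prop := exists z, is_zero z /\ nbhs z A.

Definition Gbase_of {W : Type} (N : set (set W)) : Prop :=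
  exists U : (nat -> nat) -> set W,
    (forall a, N (U a)) /\
    (forall A, N A -> exists a, U a `<=` A) /\
    (forall a b, leNN b a -> U a `<=` U b).

Definition has_Gbase : Prop := Gbase_of nbhs0.

Definition absorbs (U B : set V) : Prop :=
  exists2 r : RR, 0 < r &
    forall t x z, `|t| <= r -> B x -> is_scaled t x z -> U z.

Definition tvs_bounded (B : set V) : Prop :=
  forall U, nbhs0 U -> absorbs U B.

Definition absolutely_convex (A : set V) : Prop :=
  forall a b x y z, `|a| + `|b| <= 1 -> A x -> A y -> is_comb a x b y z -> A z.

Definition absorbing (A : set V) : Prop := forall x, absorbs A [set x].

Definition barrel (A : set V) : Prop :=
  closed A /\ absolutely_convex A /\ absorbing A.

Definition barrelled : Prop := forall A, barrel A -> nbhs0 A.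

Definition linear_functional (phi : V -> RR) : Prop :=
  forall a b x y z, is_comb a x b y z -> phi z = a * phi x + b * phi y.

Definition tdual : set (V -> RR) :=
  [set phi | continuous phi /\ linear_functional phi].

Definition strong_nbhs0 (W : set (V -> RR)) : Prop :=
  W `<=` tdual /\
  exists (B : set V) (e : RR),
    [/\ tvs_bounded B, 0 < e &
        [set phi | tdual phi /\ forall x, B x -> `|phi x| <= e] `<=` W].

Definition strong_dual_has_Gbase : Prop := Gbase_of strong_nbhs0.

Definition lin_subspace (S : set V) : Prop :=
  (exists z, is_zero z /\ S z) /\
  forall a b x y z, S x -> S y -> is_comb a x b y z -> S z.

Definition seminorm_on (S : set V) (p : V -> RR) : Prop :=
  (forall x, S x -> 0 <= p x) /\
  (forall a x z, S x -> is_scaled a x z -> p z = `|a| * p x) /\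
  (forall x y z, S x -> S y -> is_comb 1 x 1 y z -> p z <= p x + p y).

(* Regular (LM)-space: V is the locally convex inductive limit of an
   increasing sequence of metrizable locally convex spaces (E_n, tau_n),
   tau_n given by an increasing sequence of seminorms (p n k)_k that
   separates points of E_n, with tau_{n+1}|E_n <= tau_n, and every bounded
   set of V is contained and bounded in some E_n. *)
Definition regular_LM_space : Prop :=
  exists (En : nat -> set V) (p : nat -> nat -> V -> RR),
    (forall n, lin_subspace (En n)) /\
    (forall n, En n `<=` En n.+1) /\
    \bigcup_n En n = setT /\
    (forall n k, seminorm_on (En n) (p n k)) /\
    (forall n k x, En n x -> p n k x <= p n k.+1 x) /\
    (forall n x, En n x -> (forall k, p n k x = 0) -> is_zero x) /\
    (forall n k, exists j, exists2 C : RR, 0 < C &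
        forall x, En n x -> p n.+1 k x <= C * p n j x) /\
    (forall A, nbhs0 A <->
       exists2 U, absolutely_convex U /\ U `<=` A &
         forall n, exists k, exists2 e : RR, 0 < e &
           [set x | En n x /\ p n k x < e] `<=` U) /\
    (forall B, tvs_bounded B ->
       exists n, B `<=` En n /\
         forall k, exists M : RR, forall x, B x -> p n k x <= M).

End FunctionSpace.

(* Main.v *)
Require Import Defs.
From mathcomp Require Import all_boot all_order all_algebra.
From mathcomp Require Import all_classical all_reals all_analysis.
From mathcomp Require Import Rstruct Rstruct_topology.
From mathcomp Require Import ring lra.
Import Order.TTheory GRing.Theory Num.Theory.
Import numFieldNormedType.Exports.

(* The engine is one fact about a pseudometric space T: if a family of real
   functions g_a, increasing in a : N^N, dominates every continuous function on
   T, then T is separable and is a countable union of functionally bounded sets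
   (after Arhangel'skii-Calbrix and Christensen, without compactifications).

   A G-base of E = C_k(C_k(X)) yields, by polars, such a family on X; for
   metrizable X this makes X sigma-compact.  Conversely, when X is metrizable
   and sigma-compact, Ascoli's theorem gives a fundamental compact resolution of
   C_k(X).  Barrelledness is the Nachbin-Shirota theorem, since functionally
   bounded subsets of C_k(X) are relatively compact for metrizable X.

   A G-base of E'_beta yields such a family on C_k(X), which is therefore, for
   each continuous pseudometric on it, a countable union of functionally bounded
   sets.  If X is not pseudocompact, a diagonal argument along a locally finite
   sequence of bumps contradicts this; if X is compact and infinite, one along a
   discrete sequence does.  So X is finite as soon as pseudocompactness of X
   implies compactness: this covers mu-spaces and Lindeloef (hence aleph_0-)
   spaces, and makes (iii) a statement about finite X. *)

Set Implicit Arguments.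
Unset Strict Implicit.
Unset Printing Implicit Defensive.

Local Open Scope classical_set_scope.
Local Open Scope ring_scope.

(** Both kinds of G-base become dominating families by the same device. A continuous function acts
    as an evaluation functional, and the functions whose evaluation is bounded by 1 on the
    neighbourhood of index a increase with a, exhaust all continuous functions and are pointwise
    bounded; g_a is their pointwise supremum. The engine needs metric scales, which [Ck X] lacks in
    general. It is therefore run with a pseudometric on [Ck X] that is coarse enough to be
    continuous, yet fine enough to see the coordinates of the diagonal argument: capped evaluations
    along a sequence, or the uniform distance when X is compact. Each diagonal argument builds one
    function on X whose m-th coordinate, or m-th block of coordinates, excludes it from the m-th set
    of the cover. The claim on regular (LM)-spaces goes the other way: n and bounds for the
    seminorms of E_n index a cofinal family of bounded sets by N^N, and so the strong dual has a
    G-base. *)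

Lemma cvgRP (T : Type) (F : set_system T) (FF : Filter F) (f : T -> RR) (l : RR) :
  f @ F --> l <-> forall e : RR, 0 < e -> F [set y | `|f y - l| < e].
Proof.
split=> [cf e e0|cf].
  move/(@cvgrPdist_lt _ RR^o): cf => /(_ e e0).
  by apply: filterS => y /=; rewrite distrC.
by apply/(@cvgrPdist_lt _ RR^o) => e e0; apply: filterS (cf e e0) => y /=; rewrite distrC.
Qed.

Lemma cvgR_add (T : Type) (F : set_system T) (FF : Filter F) (f g : T -> RR) (l m : RR) :
  f @ F --> l -> g @ F --> m -> (fun x => f x + g x) @ F --> l + m.
Proof. exact: (@cvgD _ RR^o). Qed.

Lemma cvgR_mul (T : Type) (F : set_system T) (FF : Filter F) (f g : T -> RR) (l m : RR) :
  f @ F --> l -> g @ F --> m -> (fun x => f x * g x) @ F --> l * m.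
Proof. exact: (@cvgM (RR:realType)). Qed.

Lemma cvgR_opp (T : Type) (F : set_system T) (FF : Filter F) (f : T -> RR) (l : RR) :
  f @ F --> l -> (fun x => - f x) @ F --> - l.
Proof. exact: (@cvgN _ RR^o). Qed.

Lemma cvgR_norm (T : Type) (F : set_system T) (FF : Filter F) (f : T -> RR) (l : RR) :
  f @ F --> l -> (fun x => `|f x|) @ F --> `|l|.
Proof. exact: (@cvg_norm _ RR^o). Qed.

Lemma cvgR_inv (T : Type) (F : set_system T) (FF : Filter F) (f : T -> RR) (l : RR) :
  l != 0 -> f @ F --> l -> (fun x => (f x)^-1) @ F --> l^-1.
Proof. exact: (@cvgV (RR:realType)). Qed.

Lemma cvgR_max (T : Type) (F : set_system T) (FF : Filter F) (f g : T -> RR) (l m : RR) :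
  f @ F --> l -> g @ F --> m -> (fun x => Num.max (f x) (g x)) @ F --> Num.max l m.
Proof.
move=> cf cg.
have E (a b : RR) : Num.max a b = (a + b + `|a - b|) / 2.
  by have [|] := leP a b => h; [rewrite ler0_norm|rewrite gtr0_norm]; lra.
rewrite E (_ : (fun x => _) = fun x => (f x + g x + `|f x - g x|) / 2); last first.
  by apply/funext => x; exact: E.
apply: cvgR_mul; last exact: cvg_cst.
apply: cvgR_add; first exact: cvgR_add.
by apply: cvgR_norm; apply: cvgR_add => //; exact: cvgR_opp.
Qed.

(** Finite subcovers without choosing them: if [P K] failed, the sets [A] with [P (K \ A)] would
    form a proper filter containing [K], and its cluster point in [K] would contradict the local
    hypothesis. *)
Lemma compact_ind (T : topologicalType) (K : set T) (P : set T -> Prop) :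
  compact K -> (forall A B, A `<=` B -> P B -> P A) -> P set0 ->
  (forall A B, P A -> P B -> P (A `|` B)) ->
  (forall x, K x -> exists2 U, nbhs x U & P (K `&` U)) -> P K.
Proof.
move=> cK Psub P0 PU Ploc; apply: contrapT => nPK.
pose F := [set A : set T | P (K `\` A)].
have FF : ProperFilter F.
  split; first by rewrite /F /= setD0.
  split; rewrite /F /=.
  - by rewrite setDT.
  - move=> A B PA PB; apply: Psub (PU _ _ PA PB) => x [Kx nAB].
    by apply: contrapT => nn; apply: nAB; split; apply: contrapT => nx; apply: nn; [left|right].
  - by move=> A B AB; apply: Psub => x [Kx nB]; split => // /AB.
have [|x [Kx clx]] := cK F FF; first by rewrite /F /= setDv.
have [U xU PKU] := Ploc _ Kx.
have FU : F (~` U) by rewrite /F /= setDE setCK.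
by have [y []] := clx _ _ FU xU.
Qed.

(** * Neighbourhoods in C_k(Y) and locally finite sums *)

Definition Ckm (Y : topologicalType) (f : Y -> RR) (cf : continuous f) : Ck Y :=
  SigSub (mem_set (cf : @cont_funs Y f)).

Lemma Ckm_val (Y : topologicalType) (f : Y -> RR) (cf : continuous f) :
  Ck_val (Ckm cf) = f.
Proof. by []. Qed.

Lemma Ck_cont (Y : topologicalType) (f : Ck Y) : continuous (Ck_val f).
Proof. by case: f => f /= fP; have := set_mem fP. Qed.

Lemma Ck_inj (Y : topologicalType) (f g : Ck Y) :
  (forall y, Ck_val f y = Ck_val g y) -> f = g.
Proof. by move=> fg; apply: val_inj; apply/funext. Qed.

Lemma continuousRP (T : topologicalType) (f : T -> RR) :
  continuous f <->
  forall x (e : RR), 0 < e -> nbhs x [set y | `|f y - f x| < e].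
Proof. by split=> cf x; apply/cvgRP; exact: cf. Qed.

(** From here on the compact-open topology is used only through uniform closeness on compact
    sets. *)
Lemma Ck_nbhsP (Y : topologicalType) (f : Ck Y) (A : set (Ck Y)) :
  nbhs f A <-> exists (K : set Y) (e : RR), [/\ compact K, 0 < e &
    forall g, (forall y, K y -> `|Ck_val g y - Ck_val f y| < e) -> A g].
Proof.
have /continuousRP cf := @Ck_cont Y f.
split.
- pose F : set_system (Ck Y) := [set B : set (Ck Y) | exists (K : set Y) (e : RR), [/\ compact K, 0 < e &
    forall g, (forall y, K y -> `|Ck_val g y - Ck_val f y| < e) -> B g]].
  have FF : Filter F.
    split.
    + by exists set0, 1; split => //; exact: compact0.
    + move=> B C [K [e [cK e0 KB]]] [L [d [cL d0 LC]]].
      exists (K `|` L), (Num.min e d); split.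
      * exact: compactU.
      * by rewrite lt_min e0.
      * move=> g KLg; split.
        - by apply: KB => y Ky; have := KLg y (or_introl Ky); rewrite lt_min => /andP[].
        - by apply: LC => y Ky; have := KLg y (or_intror Ky); rewrite lt_min => /andP[].
    + by move=> B C BC [K [e [cK e0 KB]]]; exists K, e; split => // g /KB /BC.
  suff Fcvg : (set_val @ F : set_system {compact-open, Y -> RR}) -->
              (set_val f : {compact-open, Y -> RR}).
    rewrite nbhsE => -[W [[W' oW' W'E] Wf] WA].
    suff : F W by move=> [K [e [cK e0 KB]]]; exists K, e; split => // g /KB /WA.
    rewrite -W'E; apply: Fcvg; apply: open_nbhs_nbhs; split => //.
    by move: Wf; rewrite -W'E.
  apply/compact_open_cvgP => K O cK oO fKO.
  suff [e e0 eO] : exists2 e : RR, 0 < e &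
      forall y, K y -> forall r, `|r - Ck_val f y| < e -> O r.
    exists K, e; split => // g Kg _ [y Ky <-]; exact: eO (Kg _ Ky).
  apply: (@compact_ind _ K (fun B => exists2 e : RR, 0 < e &
      forall y, B y -> forall r, `|r - Ck_val f y| < e -> O r)) => //.
  + by move=> B C BC [e e0 eO]; exists e => // y /BC; exact: eO.
  + by exists 1.
  + move=> B C [e e0 eB] [d d0 dC]; exists (Num.min e d); first by rewrite lt_min e0.
    move=> y [By|Cy] r; rewrite lt_min => /andP[h1 h2]; [exact: eB h1|exact: dC h2].
  + move=> x Kx; have Ofx : O (Ck_val f x) by apply: fKO; exists x.
    have /nbhs_ballP[e /= e0 eO] : nbhs (Ck_val f x) O by apply: open_nbhs_nbhs.
    exists [set y | `|Ck_val f y - Ck_val f x| < e / 2]; first by apply: cf; lra.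
    exists (e / 2); first by lra.
    move=> y [_ /= h1] r h2; apply: eO; rewrite /ball /= distrC.
    rewrite (_ : r - _ = (r - Ck_val f y) + (Ck_val f y - Ck_val f x)); last by ring.
    by apply: le_lt_trans (ler_normD _ _) _; lra.
- move=> [K [e [cK e0 KA]]].
  suff : nbhs f [set g : Ck Y | forall y, K y -> `|Ck_val g y - Ck_val f y| < e].
    by apply: filterS.
  apply: (@compact_ind _ K (fun B => nbhs f [set g : Ck Y | forall y, B y ->
     `|Ck_val g y - Ck_val f y| < e])) => //.
  + by move=> B C BC; apply: filterS => g /= gC y /BC; exact: gC.
  + by apply: filterS filterT => g _ y.
  + move=> B C nB nC; apply: filterS (filterI nB nC) => g [gB gC] y [|]; [exact: gB|exact: gC].
  + move=> x Kx.
    exists [set y | `|Ck_val f y - Ck_val f x| < e / 3]; first by apply: cf; lra.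
    (* A subbasic open set needs a compact source, hence the non-strict bound. The errors [e / 3]
       for [f] on [C] and [e / 2] for the target ball add up to less than [e]. *)
    pose C := K `&` [set y | `|Ck_val f y - Ck_val f x| <= e / 3].
    have cC : compact C.
      apply: compact_closedI => //.
      apply: closed_comp (@closed_le _ (e / 3)) => y _.
      apply: cvgR_norm; apply: cvgR_add; last exact: cvg_cst.
      exact: Ck_cont.
    pose O := [set r : RR | `|Ck_val f x - r| < e / 2].
    have oO : open O by apply: (@ball_open _ RR^o); lra.
    have := @compact_open_open Y RR C O cC oO => oCO.
    have : nbhs f (set_val @^-1` ([set g | g @` C `<=` O] : set {compact-open, Y -> RR}) : set (Ck Y)).
      apply: open_nbhs_nbhs; split; first by exists [set g | g @` C `<=` O].
      move=> _ [y [Ky /= Cy] <-]; rewrite /O /= distrC.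
      by apply: le_lt_trans Cy _; lra.
    apply: filterS => g /= gCO y [Ky /= yx].
    have := gCO (Ck_val g y); rewrite /O /= => h.
    have {}h : `|Ck_val f x - Ck_val g y| < e / 2.
      by apply: h; exists y => //; split => //=; exact: ltW.
    rewrite distrC (_ : _ - _ = (Ck_val f y - Ck_val f x) + (Ck_val f x - Ck_val g y)); last by ring.
    by apply: le_lt_trans (ler_normD _ _) _; lra.
Qed.

(* [lfsum u t] is the sum of all [u n t] when finitely many are nonzero; otherwise
   [xget] returns its default and the value is the empty sum [0]. *)
Definition lfsum (T : Type) (u : nat -> T -> RR) (t : T) : RR :=
  \sum_(i < xget 0%N [set N | forall n, (N <= n)%N -> u n t = 0]) u i t.

Lemma lfsumE (T : Type) (u : nat -> T -> RR) t N :
  (forall n, (N <= n)%N -> u n t = 0) -> lfsum u t = \sum_(i < N) u i t.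
Proof.
have widen (a b : nat) : (a <= b)%N -> (forall n, (a <= n)%N -> u n t = 0) ->
    \sum_(i < a) u i t = \sum_(i < b) u i t.
  move=> ab ua; rewrite -!(big_mkord predT (fun i => u i t)).
  rewrite [RHS](@big_cat_nat _ _ _ a)//= [X in _ = _ + X]big_nat_cond.
  rewrite [X in _ = _ + X]big1 ?addr0// => i /andP[/andP[ai _] _].
  exact: ua.
rewrite /lfsum; case: xgetP => [M _ uM uN|uN0 uN]; last by have := uN0 N.
by have [MN|NM] := leqP M N; [exact: widen|apply/esym/widen => //; exact: ltnW].
Qed.

Section LocallyFiniteSum.
Context {T : Type} (u : nat -> T -> RR) (F : set_system T) (t : T).
Hypothesis FF : Filter F.
Hypothesis Ft : forall A, F A -> A t.
Hypothesis ucvg : forall n, u n @ F --> u n t.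
Variable N : nat.
Hypothesis uN : F [set s | forall n, (N <= n)%N -> u n s = 0].

(** Stated for a filter, so as to serve both topological neighbourhoods and the balls of a
    pseudometric. *)
Lemma lfsum_cvg : lfsum u @ F --> lfsum u t.
Proof.
have sumcvg M : (fun s => \sum_(i < M) u i s) @ F --> \sum_(i < M) u i t.
  elim: M => [|M IH].
    rewrite big_ord0 (_ : (fun _ => _) = cst 0); first exact: cvg_cst.
    by apply/funext => s; rewrite big_ord0.
  rewrite big_ord_recr (_ : (fun _ => _) = fun s => \sum_(i < M) u i s + u M s).
    exact: cvgR_add.
  by apply/funext => s; rewrite big_ord_recr.
rewrite (lfsumE (Ft uN)); apply/cvgRP => e e0.
have /cvgRP/(_ e e0) := sumcvg N.
by move=> /(filterI uN); apply: filterS => s [sN] /=; rewrite (lfsumE sN).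
Qed.

Lemma lfsum_ge n : (forall i, 0 <= u i t) -> u n t <= lfsum u t.
Proof.
move=> u0; rewrite (@lfsumE _ _ _ (maxn N n.+1)); last first.
  by move=> i; rewrite geq_max => /andP[Ni _]; exact: (Ft uN).
have nlt : (n < maxn N n.+1)%N by rewrite leq_max leqnn orbT.
by rewrite (bigD1 (Ordinal nlt))//= lerDl; exact: sumr_ge0.
Qed.

Lemma lfsum_ge0 : (forall i, 0 <= u i t) -> 0 <= lfsum u t.
Proof. by move=> u0; rewrite (lfsumE (Ft uN)); exact: sumr_ge0. Qed.

End LocallyFiniteSum.

Lemma dep_seq (T : Type) (R : nat -> seq T -> T -> Prop) :
  (forall k l, exists p, R k l p) ->
  exists p : nat -> T, forall k, R k (mkseq p k) (p k).
Proof.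
move=> exR; have hR k l : {p | R k l p} by exact/cid.
pose L := fix L k := if k is k'.+1 then rcons (L k') (sval (hR k' (L k'))) else [::].
exists (fun k => sval (hR k (L k))) => k.
suff -> : mkseq (fun k => sval (hR k (L k))) k = L k by exact: svalP.
by elim: k => //= k IH; rewrite mkseqS IH.
Qed.

(** * Domination by an increasing family on a pseudometric space *)

Definition pseudometric (T : Type) (d : T -> T -> RR) : Prop :=
  [/\ forall x, d x x = 0, forall x y, d x y = d y x &
      forall x y z, d x z <= d x y + d y z].

(** A bare filter rather than a topological structure: on [Ck X] a pseudometric has to coexist with
    the compact-open topology. *)
Definition dist_nbhs (T : Type) (d : T -> T -> RR) (x : T) : set_system T :=
  [set A | exists2 e : RR, 0 < e & [set y | d x y < e] `<=` A].

Definition dcont (T : Type) (d : T -> T -> RR) (f : T -> RR) : Prop :=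
  forall x, f @ dist_nbhs d x --> f x.

Definition dbounded (T : Type) (d : T -> T -> RR) (A : set T) : Prop :=
  forall f, dcont d f -> exists M : RR, forall x, A x -> f x <= M.

Lemma archiR (x : RR) : exists n : nat, x < n%:R.
Proof.
exists (Num.bound `|x|); apply: le_lt_trans (ler_norm _) _.
exact: archi_boundP (normr_ge0 x).
Qed.

Lemma unbounded_seq (T : Type) (A : set T) (f : T -> RR) :
  ~ (exists M : RR, forall x, A x -> f x <= M) ->
  exists x : nat -> T, (forall k, A (x k)) /\ forall k, k%:R <= f (x k).
Proof.
move=> nb; have /choice[x xP] (k : nat) : exists x, A x /\ k%:R <= f x.
  apply: contrapT => nk; apply: nb; exists k%:R => x Ax.
  by rewrite leNgt; apply/negP => /ltW kx; apply: nk; exists x.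
by exists x; split => k; case: (xP k).
Qed.

(** Near [t] the function [f] varies by less than 1, while the levels [c k] tend to infinity, so
    functions living near high levels vanish there. *)
Lemma level_locfin (T : Type) (F : set_system T) (t : T) (f : T -> RR)
    (c : nat -> RR) (u : nat -> T -> RR) :
  Filter F -> f @ F --> f t -> (forall k, k%:R <= c k) ->
  (forall k s, 1 / 2 <= `|f s - c k| -> u k s = 0) ->
  exists N, F [set s | forall n, (N <= n)%N -> u n s = 0].
Proof.
move=> FF /cvgRP/(_ 1 ltr01) Ff ck usupp.
have [N ftN] := archiR (f t + 2).
exists N; apply: filterS Ff => s /= fst n Nn; apply: usupp.
have : N%:R <= c n by apply: le_trans (ck n); rewrite ler_nat.
move: fst; rewrite ltr_norml => /andP[_ fst] Nc; rewrite ler0_norm; lra.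
Qed.

(* The diagonal device: functions agreeing with [a] on longer and longer initial
   segments have a common upper bound. *)
Lemma leNN_sup (a : nat -> nat) (b : nat -> nat -> nat) :
  (forall k i, (i < k)%N -> b k i = a i) -> exists c, forall k, leNN (b k) c.
Proof.
move=> ba; exists (fun i => maxn (a i) (\max_(k < i.+1) b k i)) => k i.
have [ik|ki] := ltnP i k; first by rewrite ba// leq_maxl.
rewrite leq_max; apply/orP; right.
by rewrite -ltnS in ki; exact: (leq_bigmax (Ordinal ki)).
Qed.

Section PseudoMetric.
Context {T : choiceType} (d : T -> T -> RR).
Hypothesis pd : pseudometric d.

Let d0 x : d x x = 0. Proof. by case: pd. Qed.
Let dC x y : d x y = d y x. Proof. by case: pd. Qed.
Let dT x y z : d x z <= d x y + d y z. Proof. by case: pd. Qed.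

Lemma dist_nbhs_filter x : Filter (dist_nbhs d x).
Proof.
split.
- by exists 1.
- move=> A B [e e0 eA] [r r0 rB]; exists (Num.min e r); first by rewrite lt_min e0.
  by move=> y /=; rewrite lt_min => /andP[h1 h2]; split; [exact: eA|exact: rB].
- by move=> A B AB [e e0 eA]; exists e => //; exact: subset_trans AB.
Qed.

Lemma dist_nbhs_ball x (e : RR) : 0 < e -> dist_nbhs d x [set y | d x y < e].
Proof. by move=> e0; exists e. Qed.

Lemma dist_nbhs_self x A : dist_nbhs d x A -> A x.
Proof. by move=> [e e0]; apply; rewrite /= d0. Qed.

Lemma dcont_dist p : dcont d (d p).
Proof.
move=> x; apply/cvgRP; first exact: dist_nbhs_filter.
move=> e e0; exists e => // y /= xy; rewrite ltr_norml.
by have := dT p x y; have := dT p y x; rewrite (dC y x); lra.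
Qed.

Lemma dcont_bump p (c k : RR) : dcont d (fun x => Num.max 0 (c - k * d p x)).
Proof.
move=> x; have FF := dist_nbhs_filter x; apply: cvgR_max; first exact: cvg_cst.
apply: cvgR_add; first exact: cvg_cst.
apply: cvgR_opp; apply: cvgR_mul; [exact: cvg_cst|exact: dcont_dist].
Qed.

(** Separated centres carry a locally finite family of bumps, whose heights are therefore arbitrary.
    In particular a [dbounded] set contains no infinite separated sequence. *)
Lemma separated_unbounded (q : nat -> T) (e : RR) (c : nat -> RR) :
  0 < e -> (forall j k, j != k -> e <= d (q j) (q k)) -> (forall k, 0 <= c k) ->
  exists2 f, dcont d f & (forall x, 0 <= f x) /\ forall k, c k <= f (q k).
Proof.
move=> e0 qsep c0.
pose u k x := Num.max 0 (c k - c k * 3 / e * d (q k) x).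
have usupp k x : u k x != 0 -> d (q k) x < e / 3.
  move=> ukx; have [//|h] := ltP; case/negP: ukx; apply/eqP/max_l.
  suff : c k <= c k * (3 / e * d (q k) x) by lra.
  rewrite -{1}[c k]mulr1 ler_wpM2l// mulrAC -mulrA mulrC.
  by rewrite mulrAC ler_pdivlMr//; lra.
have u0 k x : 0 <= u k x by rewrite /u le_max lexx.
have uloc t : exists N, dist_nbhs d t [set s | forall n, (N <= n)%N -> u n s = 0].
  (* If two bumps met the ball of radius [e / 6] about [t], their centres would be closer than e/3 +
     e/6 + e/6 + e/3 = e. *)
  have [[j [s0 [ts0 uj]]]|nex] := pselect (exists j s0, d t s0 < e / 6 /\ u j s0 != 0).
    exists j.+1; exists (e / 6); first by lra.
    move=> s /= ts n jn; apply: contrapT => /eqP un.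
    have jn' : j != n by rewrite neq_ltn jn.
    have := qsep _ _ jn'; have := usupp _ _ uj; have := usupp _ _ un.
    have := dT (q j) s0 (q n); have := dT s0 t (q n); have := dT t s (q n).
    by rewrite (dC s0 t) (dC s (q n)); lra.
  exists 0%N; exists (e / 6); first by lra.
  move=> s /= ts n _; apply: contrapT => /eqP un; apply: nex; by exists n, s.
exists (lfsum u); last split.
- move=> t; have [N uN] := uloc t; have FF := dist_nbhs_filter t.
  by apply: (lfsum_cvg FF _ _ uN) => [A|n]; [exact: dist_nbhs_self|exact: dcont_bump].
- by move=> t; have [N uN] := uloc t; apply: (lfsum_ge0 _ uN) => // A; exact: dist_nbhs_self.
- move=> k; have [N uN] := uloc (q k).
  apply: le_trans (lfsum_ge _ uN k _); first by rewrite /u d0 mulr0 subr0 le_max lexx orbT.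
  + by move=> A; exact: dist_nbhs_self.
  + by [].
Qed.

Section Domination.
Variable g : (nat -> nat) -> T -> RR.
Hypothesis g_mono : forall a b x, leNN a b -> g a x <= g b x.
Hypothesis g_dom : forall f, dcont d f -> (forall x, 0 <= f x) ->
  exists a, forall x, f x <= g a x.

(** The uncountable index set is reached through its countable tree of finite sequences: [dom s f]
    records only that some branch through the node [s] dominates [f]. *)
Let dom (s : seq nat) (f : T -> RR) : Prop :=
  exists a, (forall i, (i < size s)%N -> a i = nth 0%N s i) /\ forall x, f x <= g a x.

Let dom_rcons s f : dom s f -> exists n, dom (rcons s n) f.
Proof.
move=> [a [sa fa]]; exists (a (size s)), a; split => // i.
rewrite size_rcons ltnS leq_eqVlt nth_rcons => /predU1P[->|is_].
  by rewrite ltnn eqxx.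
by rewrite is_ sa.
Qed.

Let dom_le s f h : (forall x, h x <= f x) -> dom s f -> dom s h.
Proof. by move=> hf [a [sa fa]]; exists a; split => // x; exact: le_trans (fa x). Qed.

(** The dominating indices agree with [a] on longer and longer segments, so by [leNN_sup] they lie
    below one [c], and monotonicity puts every [f k] under [g c]. *)
Let branch_bounded (a : nat -> nat) (f : nat -> T -> RR) x :
  (forall k, dom (mkseq a k) (f k)) -> exists M : RR, forall k, f k x <= M.
Proof.
move=> /choice[b bP].
have [|c bc] := @leNN_sup a b.
  by move=> k i ik; have [-> //] := bP k; rewrite ?size_mkseq// nth_mkseq.
exists (g c x) => k; have [_ fk] := bP k.
by apply: le_trans (fk x) _; exact: g_mono.
Qed.

Let rad (m : nat) : RR := m.+1%:R^-1.

Let rad_gt0 m : 0 < rad m. Proof. by rewrite invr_gt0 ltr0n. Qed.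

Let rad_small (e : RR) : 0 < e -> exists m, rad m < e.
Proof.
move=> e0; have [m em] := archiR e^-1; exists m.
rewrite /rad invf_plt ?posrE ?ltr0n//.
by apply: lt_trans em _; rewrite ltr_nat.
Qed.

(* Each function supported in the ball of radius [rad m] about [x] is dominated
   by some [g a] with [a] extending [s]. *)
Let good (s : seq nat) (x : T) (m : nat) : Prop :=
  forall f, dcont d f -> (forall y, 0 <= f y) ->
    (forall y, rad m <= d x y -> f y = 0) -> dom s f.

(* Points which are good for [s] and for no extension of [s] by one term.  A point
   outside all cores would start an infinite branch [a], and tall bumps at it would
   all lie under a single [g c]; hence the countably many cores cover the space. *)
Let core (s : seq nat) (m : nat) : set T :=
  [set x | good s x m /\ forall n k, ~ good (rcons s n) x k].

Let core_cover x : exists s m, core s m x.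
Proof.
apply: contrapT => ncore.
have step (s : seq nat) m : exists p : nat * nat, good s x m -> good (rcons s p.1) x p.2.
  apply: contrapT => nstep; apply: ncore; exists s, m; split.
    by apply: contrapT => ng; apply: nstep; exists (0, 0)%N.
  by move=> n k gnk; apply: nstep; exists (n, k).
have {}step : forall sm : seq nat * nat, exists p : nat * nat,
  good sm.1 x sm.2 -> good (rcons sm.1 p.1) x p.2 by move=> [s m]; exact: step.
have [w wP] := choice step.
pose L := fix L k := if k is k'.+1 then (rcons (L k').1 (w (L k')).1, (w (L k')).2)
                     else ([::], 0%N).
pose a k := (w (L k)).1.
have LE k : (L k).1 = mkseq a k by elim: k => //= k ->; rewrite mkseqS.
have gL k : good (mkseq a k) x (L k).2.
  rewrite -LE; elim: k => [|k IH]; last exact: wP.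
  by move=> f cf f0 _; have [b fb] := g_dom cf f0; exists b.
have [k|M MP] := @branch_bounded a
    (fun k y => Num.max 0 (k%:R - k%:R / rad (L k).2 * d x y)) x.
  apply: gL => [|y|y rxy]; [exact: dcont_bump|by rewrite le_max lexx|].
  apply: max_l; rewrite subr_le0 -{1}[k%:R]mulr1 -mulrA ler_wpM2l//.
  by rewrite mulrC ler_pdivlMr ?rad_gt0// mul1r.
have [k Mk] := archiR M.
by have := MP k; rewrite d0 mulr0 subr0 ge_max => /andP[_]; rewrite leNgt Mk.
Qed.

(* If [f] were unbounded there, functions [u k] witnessing badness for [rcons s k]
   could be chosen near levels of [f] tending to infinity, so that they are locally
   finite; their sum is dominated at [s], hence at some [rcons s n], and so is [u n]. *)
Let core_bounded s m p : dbounded d (core s m `&` [set x | d p x < rad m / 4]).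
Proof.
move=> f cf; apply: contrapT => /unbounded_seq[x [xA kx]].
have rho k : exists r, [/\ 0 < r, r < rad m / 4 & forall y, d (x k) y < r ->
    `|f y - f (x k)| < 1 / 2].
  have FF := dist_nbhs_filter (x k); have h2 : 0 < 1 / 2 :> RR by lra.
  have /cvgRP/(_ _ h2)[r r0 rP] := cf (x k).
  have rm := rad_gt0 m; exists (Num.min r (rad m / 8)); split.
  - by rewrite lt_min r0/=; lra.
  - by rewrite gt_min; apply/orP; right; lra.
  - by move=> y; rewrite lt_min => /andP[/rP].
have bad k : exists u, [/\ dcont d u, forall y, 0 <= u y,
    forall y, u y != 0 -> d (x k) y < rad m / 4 /\ `|f y - f (x k)| < 1 / 2 &
    ~ dom (rcons s k) u].
  have [r [r0 rm rf]] := rho k.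
  have [n nr] := rad_small r0.
  have [[_ ng] _] := xA k.
  apply: contrapT => nex; apply: (ng k n) => u cu u0 us.
  apply: contrapT => ndom; apply: nex; exists u; split => // y uy.
  have [ry|yr] := leP (rad n) (d (x k) y); first by move: uy; rewrite us ?eqxx.
  by split; [|apply: rf]; lra.
have [u /all_and4[uc u0 us und]] := choice bad.
have uloc t : exists N, dist_nbhs d t [set s | forall n, (N <= n)%N -> u n s = 0].
  apply: (@level_locfin _ _ _ f (fun k => f (x k))) => //.
  - exact: dist_nbhs_filter.
  - move=> k y h; apply: contrapT => /eqP /us[_]; lra.
(* Here the radius [rad m / 4] pays off: all supports lie within 3/4 of [rad m] from [x 0], so
   goodness at this single point applies to the whole sum. *)
have [[gd _] px0] := xA 0%N.
have : dom s (lfsum u).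
  apply: gd.
  - move=> t; have [N uN] := uloc t; have FF := dist_nbhs_filter t.
    by apply: (lfsum_cvg FF _ _ uN) => [A|n]; [exact: dist_nbhs_self|exact: uc].
  - by move=> t; have [N uN] := uloc t; apply: (lfsum_ge0 _ uN) => // A; exact: dist_nbhs_self.
  - move=> y ry; rewrite (@lfsumE _ _ _ 0%N) ?big_ord0// => n _.
    apply: contrapT => /eqP /us[xny _]; have [_ /= pxn] := xA n.
    move: px0 => /= px0.
    have := dT (x 0%N) p y; have := dT p (x n) y; rewrite (dC (x 0%N) p).
    by have := rad_gt0 m; lra.
move=> /dom_rcons[n domn]; apply: (und n).
apply: dom_le domn => y; have [N uN] := uloc y.
by apply: (lfsum_ge _ uN) => // A; exact: dist_nbhs_self.
Qed.

(** A maximal [e]-separated set, given by Zorn, is an [e]-net. The work lies in its countability. *)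
Lemma dominated_net (t0 : T) (e : RR) : 0 < e ->
  exists q : nat -> T, forall x, exists k, d (q k) x < e.
Proof.
move=> e0.
pose sep (D : set T) := forall x y, D x -> D y -> x != y -> e <= d x y.
have [D [Dsep Dmax]] : exists D, sep D /\ forall B, D `<` B -> ~ sep B.
  apply: Zorn_bigcup => F Fsep Ftot x y [A FA Ax] [B FB By].
  have [AB|BA] := Ftot _ _ FA FB; first by apply: (Fsep B) => //; exact: AB.
  by apply: (Fsep A) => //; exact: BA.
have Dnet x : exists2 p, D p & d p x < e.
  apply: contrapT => nx; have {}nx p : D p -> e <= d p x.
    by move=> Dp; have [//|h] := leP e (d p x); case: nx; exists p.
  apply: (Dmax (D `|` [set x])).
    split; last by move=> h; have /nx := h x (or_intror erefl); rewrite d0; lra.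
    by move=> y Dy; left.
  move=> y z [Dy|->] [Dz|->] yz; [exact: Dsep|exact: nx|by rewrite dC; exact: nx|].
  by rewrite eqxx in yz.
suff cD : countable D.
  have /countable_injP[f finj] := cD.
  exists (fun n => xget t0 [set p | D p /\ f p = n]) => x.
  have [p Dp px] := Dnet x; exists (f p).
  case: xgetP => [y _ [Dy fy]|/(_ p) np]; last by case: np.
  by rewrite (finj _ _ _ _ fy) ?inE.
apply: contrapT => ncD.
(* For each branch [a], some [Ds (mkseq a c, c)] is infinite.  Assigning to every
   code [(s, c)] its own point of [Ds (s, c)] with prescribed value [c + 1] gives
   a continuous function under no [g a]. *)
pose Ds (sc : seq nat * nat) := [set x | D x /\ forall f, dom sc.1 f -> f x <= sc.2%:R].
(* Were these sets finite, some point of the uncountable [D] would lie in none of them; every node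
   [mkseq a c] would then dominate a function exceeding [c] there, against [branch_bounded]. *)
have Dsinf a : exists c, infinite_set (Ds (mkseq a c, c)).
  apply: contrapT => nex; apply: ncD.
  apply: (@sub_countable _ _ _ (\bigcup_c Ds (mkseq a c, c))); last first.
    apply: bigcup_countable => // c _; apply: finite_set_countable.
    by apply: contrapT => h; apply: nex; exists c.
  apply: subset_card_le => x Dx; apply: contrapT => nx.
  have /choice[f fP] c : exists f, dom (mkseq a c) f /\ c%:R < f x.
    apply: contrapT => nf; apply: nx; exists c => //; split => // f domf.
    by rewrite leNgt; apply/negP => h; apply: nf; exists f.
  have [M MP] := @branch_bounded a f x (fun k => (fP k).1).
  have [k Mk] := archiR M.
  by have := MP k; have [_] := fP k; lra.
have pick_new (A : set T) (l : seq T) : infinite_set A -> exists2 p, A p & p \notin l.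
  move=> infA; apply: contrapT => np; apply: infA.
  apply: (@sub_finite_set _ _ [set` l]); last exact: finite_seq.
  by move=> p Ap /=; apply: contrapT => /negP pl; apply: np; exists p.
have infD : infinite_set D by move=> /finite_set_countable.
have [k l|p pP] := @dep_seq T (fun k l p => [/\ D p, p \notin l &
    forall sc, unpickle k = Some sc -> infinite_set (Ds sc) -> Ds sc p]).
  case E : (unpickle k) => [sc|]; last first.
    by have [p Dp pl] := pick_new D l infD; exists p.
  have [fin|inf] := pselect (finite_set (Ds sc)).
    have [p Dp pl] := pick_new D l infD; exists p; split => // _ [<-] //.
  have [p Dsp pl] := pick_new _ l inf; exists p; split => //; first by case: Dsp.
  by move=> _ [<-].
have pne j k : (j < k)%N -> p j != p k.
  move=> jk; have [_ + _] := pP k; apply: contraNneq => <-.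
  by apply/mapP; exists j => //; rewrite mem_iota.
have [|k|f cf [f0 fp]] := @separated_unbounded p e
    (fun k => if @unpickle (seq nat * nat)%type k is Some sc then sc.2.+1%:R else 0) e0.
- move=> j k jk; have [Dj _ _] := pP j; have [Dk _ _] := pP k; apply: Dsep => //.
  by move: jk; rewrite neq_ltn => /orP[/pne//|/pne]; rewrite eq_sym.
- by case: unpickle.
have [a fa] := g_dom cf f0.
have [n ninf] := Dsinf a.
have [_ _ /(_ _ (pickleK _) ninf)[_ /(_ f)/=]] := pP (pickle (mkseq a n, n)).
have := fp (pickle (mkseq a n, n)); rewrite pickleK /= => h1 h2.
have : f (p (pickle (mkseq a n, n))) <= n%:R.
  by apply: h2; exists a; split => // i; rewrite size_mkseq => im; rewrite nth_mkseq.
by move=> /(le_trans h1); rewrite ler_nat ltnn.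
Qed.

(** The cores are indexed by countably many pairs [(s, m)], and a countable net of mesh [rad m / 4]
    cuts each into pieces to which [core_bounded] applies. *)
Lemma dominated_cover (t0 : T) :
  exists Q : nat -> set T, (forall n, dbounded d (Q n)) /\ forall x, exists n, Q n x.
Proof.
have /choice[q qP] m : exists q : nat -> T, forall x, exists k, d (q k) x < rad m / 4.
  by apply: dominated_net => //; rewrite divr_gt0.
exists (fun k => if @unpickle (seq nat * nat * nat)%type k is Some (s, m, i)
  then core s m `&` [set x | d (q m i) x < rad m / 4] else set0); split.
  move=> k; case: unpickle => [[[s m] i]|]; first exact: core_bounded.
  by move=> f _; exists 0.
move=> x; have [s [m sm]] := core_cover x; have [i xi] := qP m x.
by exists (pickle (s, m, i)); rewrite pickleK.
Qed.

End Domination.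
End PseudoMetric.

(** * Functional boundedness in Lindeloef spaces *)

Lemma continuous_bounded_compact (T : topologicalType) (K : set T) (f : T -> RR) :
  compact K -> continuous f -> exists M : RR, forall x, K x -> `|f x| <= M.
Proof.
move=> cK cf; apply: (@compact_ind _ K (fun B => exists M : RR, forall x, B x -> `|f x| <= M) cK).
- by move=> A B AB [M MP]; exists M => x /AB; exact: MP.
- by exists 0.
- move=> A B [M MP] [N NP]; exists (Num.max M N) => x [Ax|Bx].
    by rewrite le_max MP.
  by rewrite le_max NP ?orbT.
- move=> x Kx; exists [set y | `|f y - f x| < 1]; first exact: ((continuousRP f).1 cf).
  exists (`|f x| + 1) => y [_ /= yx].
  have := ler_normD (f y - f x) (f x); rewrite subrK; lra.
Qed.

Lemma continuousR_cst (T : topologicalType) (c : RR) : continuous (fun _ : T => c).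
Proof. by move=> x; exact: cvg_cst. Qed.

Lemma continuousR_add (T : topologicalType) (f g : T -> RR) :
  continuous f -> continuous g -> continuous (fun x => f x + g x).
Proof. by move=> cf cg x; apply: cvgR_add; [exact: cf|exact: cg]. Qed.

Lemma continuousR_opp (T : topologicalType) (f : T -> RR) :
  continuous f -> continuous (fun x => - f x).
Proof. by move=> cf x; apply: cvgR_opp; exact: cf. Qed.

Lemma continuousR_mul (T : topologicalType) (f g : T -> RR) :
  continuous f -> continuous g -> continuous (fun x => f x * g x).
Proof. by move=> cf cg x; apply: cvgR_mul; [exact: cf|exact: cg]. Qed.

Lemma continuousR_scale (T : topologicalType) (c : RR) (f : T -> RR) :
  continuous f -> continuous (fun x => c * f x).
Proof. by move=> cf; apply: continuousR_mul => //; exact: continuousR_cst. Qed.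

Lemma continuousR_max (T : topologicalType) (f g : T -> RR) :
  continuous f -> continuous g -> continuous (fun x => Num.max (f x) (g x)).
Proof. by move=> cf cg x; apply: cvgR_max; [exact: cf|exact: cg]. Qed.

Lemma continuousR_abs (T : topologicalType) (f : T -> RR) :
  continuous f -> continuous (fun x => `|f x|).
Proof. by move=> cf x; apply: cvgR_norm; exact: cf. Qed.

Lemma continuousR_inv (T : topologicalType) (f : T -> RR) :
  (forall x, f x != 0) -> continuous f -> continuous (fun x => (f x)^-1).
Proof. by move=> f0 cf x; apply: cvgR_inv => //; exact: cf. Qed.

Lemma continuousR_bump (T : topologicalType) (f : T -> RR) (c k : RR) :
  continuous f -> continuous (fun x => Num.max 0 (c - k * f x)).
Proof.
move=> cf; apply: continuousR_max; first exact: continuousR_cst.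
apply: continuousR_add; first exact: continuousR_cst.
by apply: continuousR_opp; exact: continuousR_scale.
Qed.

Lemma lfsum_continuous (T : topologicalType) (u : nat -> T -> RR) :
  (forall n, continuous (u n)) ->
  (forall t : T, exists N, nbhs t [set s | forall n, (N <= n)%N -> u n s = 0]) ->
  continuous (lfsum u).
Proof.
move=> uc uloc t; have [N uN] := uloc t.
by apply: (lfsum_cvg _ _ _ uN) => [A|n]; [exact: nbhs_singleton|exact: uc].
Qed.

Lemma lfsum_nbhs_ge (T : topologicalType) (u : nat -> T -> RR) t n :
  (forall t : T, exists N, nbhs t [set s | forall n, (N <= n)%N -> u n s = 0]) ->
  (forall i, 0 <= u i t) -> u n t <= lfsum u t.
Proof.
move=> uloc; have [N uN] := uloc t.
by apply: (lfsum_ge _ uN) => A; exact: nbhs_singleton.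
Qed.

Lemma tychonoff_bump (X : topologicalType) (x : X) (U : set X) :
  tychonoff_space X -> nbhs x U ->
  exists u : X -> RR, [/\ continuous u, forall y, 0 <= u y, u x = 1 &
    forall y, ~ U y -> u y = 0].
Proof.
move=> [_ tyX]; rewrite nbhsE => -[V [oV Vx] VU].
have [||f [cf [fx fV]]] := tyX (~` V) x; first exact: open_closedC.
  by apply.
exists (fun y => Num.max 0 (1 - 1 * `|f y|)); split.
- by apply: continuousR_bump; exact: continuousR_abs.
- by move=> y; rewrite le_max lexx.
- by rewrite fx normr0 mulr0 subr0 max_r.
- by move=> y nUy; rewrite fV ?normr1 ?mulr1 ?subrr ?maxxx// => /VU.
Qed.

(** The subcover is listed by a sequence of centres in [X], so the empty space does not qualify;
    hence the base points in the lemmas that produce this property. *)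
Definition lindelof_space (X : topologicalType) : Prop :=
  forall V : X -> set X, (forall x, nbhs x (V x)) ->
  exists s : nat -> X, forall y, exists k, V (s k) y.

(** If a filter on [A] has no cluster point in [A], every point has a neighbourhood whose complement
    belongs to it, and countably many of these cover. [t k] measures what the first [k + 1] bumps
    leave uncovered. Near each point a bump above 3/4 kills all later [t k], so their sum is
    continuous; at a point of [A] outside the first [N] neighbourhoods it is at least
    [N * (3 / 4)]. *)
Lemma lindelof_bounded_compact (X : topologicalType) (A : set X) :
  tychonoff_space X -> lindelof_space X -> closed A -> functionally_bounded A ->
  compact A.
Proof.
move=> tyX liX clA fbA F FF FA; apply: contrapT => ncl.
have {}ncl (x : X) : exists2 V, nbhs x V & F (~` V).
  have [Ax|nAx] := pselect (A x); last first.
    exists (~` A); last by rewrite setCK.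
    by apply: open_nbhs_nbhs; split => //; exact: closed_openC.
  apply: contrapT => nV; apply: ncl; exists x; split => // B V FB xV.
  apply: contrapT => BV; apply: nV; exists V => //.
  by apply: filterS FB => y By Vy; apply: BV; exists y.
have {ncl}/choice[V VP] : forall x : X, exists V, nbhs x V /\ F (~` V).
  by move=> x; have [V] := ncl x; exists V.
have /choice[u uP] : forall x, exists u : X -> RR, [/\ continuous u,
    forall y, 0 <= u y, u x = 1 & forall y, ~ V x y -> u y = 0].
  by move=> x; apply: tychonoff_bump => //; case: (VP x).
have [x|s sP] := liX (fun x => [set y | 3 / 4 < u x y]).
  have [cu _ ux _] := uP x; have /continuousRP/(_ x (1/4)) := cu.
  have h4 : 0 < 1 / 4 :> RR by lra.
  rewrite ux => /(_ h4); apply: filterS => y /=; rewrite ltr_norml => /andP[]; lra.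
pose t k x := Num.max 0 (3 / 4 - 1 * \sum_(j < k.+1) u (s j) x).
have sumc k : continuous (fun x => \sum_(j < k) u (s j) x).
  elim: k => [|k IH].
    rewrite (_ : (fun _ => _) = fun _ => 0); first exact: continuousR_cst.
    by apply/funext => x; rewrite big_ord0.
  rewrite (_ : (fun _ => _) = fun x => \sum_(j < k) u (s j) x + u (s k) x).
    by apply: continuousR_add => //; case: (uP (s k)).
  by apply/funext => x; rewrite big_ord_recr.
have tc k : continuous (t k) by exact: continuousR_bump.
have t0 k x : 0 <= t k x by rewrite le_max lexx.
have u0 k x : 0 <= u (s k) x by case: (uP (s k)).
have tloc (x : X) : exists N, nbhs x [set y | forall n, (N <= n)%N -> t n y = 0].
  have [k ukx] := sP x; exists k.
  have [cu _ _ _] := uP (s k); have /continuousRP/(_ x (u (s k) x - 3 / 4)) := cu.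
  rewrite subr_gt0 => /(_ ukx); apply: filterS => y /=.
  rewrite ltr_norml => /andP[uky _] n kn; apply: max_l.
  have kn' : (k < n.+1)%N by [].
  rewrite (bigD1 (Ordinal kn'))//=.
  have : 0 <= \sum_(i < n.+1 | i != Ordinal kn') u (s i) y by exact: sumr_ge0.
  by move: uky; lra.
have [M MP] := fbA _ (lfsum_continuous tc tloc).
have [N MN] := archiR (M * 4 / 3).
have : F (A `&` [set y | forall j, (j < N)%N -> ~ V (s j) y]).
  apply: filterI => //; elim: N {MN} => [|N IH]; first by apply: filterS FA => y _ [].
  have [_ FV] := VP (s N); apply: filterS (filterI IH FV) => y [yN Vy] j.
  by rewrite ltnS leq_eqVlt => /predU1P[->|/yN].
move=> /filter_ex[y [Ay yN]].
have := MP _ Ay; apply/negP; rewrite -ltNge.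
apply: lt_le_trans (ler_norm _).
have ty k : (k < N)%N -> t k y = 3 / 4.
  move=> kN; rewrite /t big1 ?mulr0 ?subr0; first by rewrite max_r; lra.
  move=> j _; have [_ _ _] := uP (s j); apply; apply: yN.
  exact: leq_trans kN.
have [L yL] := tloc y; have {}yL := nbhs_singleton yL.
have [NL|LN] := leqP N L; last by have := yL L (leqnn _); rewrite ty //; lra.
rewrite (lfsumE yL) -(subnKC NL) big_split_ord/=.
have -> : \sum_(i < N) t (lshift (L - N) i) y = N%:R * (3 / 4).
  rewrite (eq_bigr (fun=> 3 / 4)) => [|i _]; last by rewrite /= ty.
  by rewrite sumr_const card_ord [RHS]mulr_natl.
have : 0 <= \sum_(i < L - N) t (rshift N i) y by exact: sumr_ge0.
by move: MN; lra.
Qed.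

(** * The space of continuous functions with the compact-open topology *)

(** Adjoining 0 keeps the supremum over a nonempty set when [K] is empty. *)
Definition snorm (X : Type) (K : set X) (h : X -> RR) : RR :=
  sup ([set `|h x| | x in K] `|` [set 0]).

Lemma snorm_le (X : Type) (K : set X) (h : X -> RR) (M : RR) :
  0 <= M -> (forall x, K x -> `|h x| <= M) -> snorm K h <= M.
Proof.
move=> M0 KM; apply: ge_sup; first by exists 0; right.
by move=> _ [[x Kx <-]|->] //; exact: KM.
Qed.

Lemma snorm_has_ubound (X : topologicalType) (K : set X) (h : X -> RR) :
  compact K -> continuous h -> has_ubound ([set `|h x| | x in K] `|` [set 0]).
Proof.
move=> cK ch; have [M MP] := continuous_bounded_compact cK ch.
exists (Num.max M 0) => _ [[x Kx <-]|->]; last by rewrite le_max lexx orbT.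
by rewrite le_max MP.
Qed.

Lemma snorm_ge (X : topologicalType) (K : set X) (h : X -> RR) x :
  compact K -> continuous h -> K x -> `|h x| <= snorm K h.
Proof.
by move=> cK ch Kx; apply: ub_le_sup; [exact: snorm_has_ubound|left; exists x].
Qed.

Lemma snorm_ge0 (X : topologicalType) (K : set X) (h : X -> RR) :
  compact K -> continuous h -> 0 <= snorm K h.
Proof. by move=> cK ch; apply: ub_le_sup; [exact: snorm_has_ubound|right]. Qed.

Definition cdist (X : topologicalType) (K : set X) (f g : Ck X) : RR :=
  snorm K (fun x => Ck_val f x - Ck_val g x).

Section CkDist.
Context {X : topologicalType} (K : set X).
Hypothesis cK : compact K.

Lemma Ck_sub_continuous (f g : Ck X) : continuous (fun x => Ck_val f x - Ck_val g x).
Proof.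
by apply: continuousR_add; [exact: Ck_cont|apply: continuousR_opp; exact: Ck_cont].
Qed.

Lemma cdist_ge (f g : Ck X) x : K x -> `|Ck_val f x - Ck_val g x| <= cdist K f g.
Proof. by move=> Kx; exact: (snorm_ge cK (@Ck_sub_continuous f g) Kx). Qed.

Lemma cdist_ge0 (f g : Ck X) : 0 <= cdist K f g.
Proof. exact: (snorm_ge0 cK (@Ck_sub_continuous f g)). Qed.

Lemma cdist_pseudometric : pseudometric (cdist K).
Proof.
split=> [f|f g|f g h].
- apply/eqP; rewrite eq_le cdist_ge0 andbT.
  by apply: snorm_le => // x _; rewrite subrr normr0.
- by apply/eqP; rewrite eq_le; apply/andP; split; (apply: snorm_le;
    [exact: cdist_ge0|move=> x Kx; rewrite distrC; exact: cdist_ge]).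
- apply: snorm_le; first by rewrite addr_ge0 ?cdist_ge0.
  move=> x Kx; apply: le_trans (lerD (cdist_ge f g Kx) (cdist_ge g h Kx)).
  by apply: le_trans (ler_normD _ _); rewrite addrA subrK.
Qed.

Lemma dcont_cdist_continuous (F : Ck X -> RR) :
  dcont (cdist K) F -> continuous F.
Proof.
move=> cF; apply/continuousRP => f e e0.
have FF := dist_nbhs_filter (cdist K) f.
have /cvgRP/(_ e e0)[r r0 rP] := cF f.
apply/Ck_nbhsP; exists K, (r / 2); split => //; first by lra.
move=> g gf; apply: rP => /=; suff : cdist K f g <= r / 2 by lra.
apply: snorm_le; first by lra.
by move=> x Kx; rewrite distrC ltW// gf.
Qed.

End CkDist.

(** The separation property on which barrelledness will rest; for [Ck X] it comes directly from the
    sup seminorms. *)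
Definition bumps (Y : topologicalType) : Prop :=
  forall (y : Y) (U : set Y), nbhs y U ->
  exists u : Y -> RR, [/\ continuous u, forall z, 0 <= u z, u y = 1 &
    forall z, ~ U z -> u z = 0].

Lemma Ck_bumps (X : topologicalType) : bumps (Ck X).
Proof.
move=> f U /Ck_nbhsP[K [e [cK e0 KU]]].
have pd := cdist_pseudometric cK; have [d0 _ _] := pd.
exists (fun g => Num.max 0 (1 - e^-1 * cdist K f g)); split.
- apply: (dcont_cdist_continuous cK); exact: dcont_bump.
- by move=> g; rewrite le_max lexx.
- by rewrite d0 mulr0 subr0 max_r.
- move=> g nUg; apply: max_l; rewrite subr_le0 mulrC ler_pdivlMr// mul1r.
  rewrite leNgt; apply/negP => h; apply: nUg; apply: KU => y Ky.
  by rewrite distrC; apply: le_lt_trans h; exact: cdist_ge.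
Qed.

Lemma Ck_eval_continuous (X : topologicalType) (x : X) :
  continuous (fun f : Ck X => Ck_val f x).
Proof.
apply/continuousRP => f e e0; apply/Ck_nbhsP; exists [set x], e; split => //.
  exact: compact_set1.
by move=> g; apply.
Qed.

Lemma closed_cvg_mem (T : topologicalType) (A : set T) (F : set_system T) (t : T) :
  ProperFilter F -> closed A -> F A -> F --> t -> A t.
Proof.
move=> FF clA FA Ft; apply: clA => B tB.
by apply: (@filter_ex _ F); apply: filterI => //; exact: Ft.
Qed.

(** Along an ultrafilter on [H] the values at each point converge by boundedness. Equicontinuity
    makes the limit continuous and the convergence uniform on compact sets. *)
Lemma Ck_ascoli (X : topologicalType) (H : set (Ck X)) :
  closed H ->
  (forall x, exists M : RR, forall f, H f -> `|Ck_val f x| <= M) ->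
  (forall x (e : RR), 0 < e -> exists2 U, nbhs x U &
     forall f y, H f -> U y -> `|Ck_val f y - Ck_val f x| <= e) ->
  compact H.
Proof.
move=> clH Hpb Heq; rewrite compact_ultra => F UF FH.
have FF : ProperFilter F by exact: ultra_proper.
have /choice[l lP] : forall x, exists l : RR, (fun f => Ck_val f x) @ F --> l.
  move=> x; have [M MP] := Hpb x.
  have cM : compact [set r : RR | - M <= r <= M].
    rewrite (_ : mkset _ = `[- M, M]%classic); last by apply/seteqP; split => r /=; rewrite in_itv.
    exact: (@segment_compact (RR : realType)).
  have FM : F [set f | - M <= Ck_val f x <= M].
    by apply: filterS FH => f /MP /=; rewrite ler_norml.
  have [l [_ lcl]] := cM ((fun f => Ck_val f x) @ F) _ FM.
  exists l; apply/cvgRP => e e0.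
  have [//|Fn] := in_ultra_setVsetC [set f | `|Ck_val f x - l| < e] UF.
  have [|r [/= nr lr]] := lcl (~` [set r : RR | `|r - l| < e]) [set r : RR | `|r - l| < e] Fn.
    by have /cvgRP := @cvg_id _ (nbhs l); apply.
  by case: nr.
have lF x e : 0 < e -> F [set f | `|Ck_val f x - l x| < e].
  by move=> e0; have /cvgRP := lP x; apply.
have lH x (e : RR) : 0 < e -> exists2 U, nbhs x U &
   forall y, U y -> `|l y - l x| <= e.
  move=> e0; have e3 : 0 < e / 3 by lra.
  have [U xU HU] := Heq x _ e3; exists U => // y Uy.
  have [f [Hf [/= fx fy]]] := filter_ex (filterI FH (filterI (lF x _ e3) (lF y _ e3))).
  have := HU _ _ Hf Uy.
  move: fx fy; rewrite !ltr_norml !ler_norml => /andP[? ?] /andP[? ?] /andP[? ?].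
  by apply/andP; split; lra.
have cl : continuous l.
  apply/continuousRP => x e e0; have [|U xU UP] := lH x (e / 2); first by lra.
  by apply: filterS xU => y /UP h /=; apply: le_lt_trans h _; lra.
suff Fl : F --> (Ckm cl : Ck X) by exists (Ckm cl); split => //; exact: closed_cvg_mem FH Fl.
move=> A /Ck_nbhsP[K [e [cK e0 KA]]].
suff : F [set f | forall y, K y -> `|Ck_val f y - l y| < e] by apply: filterS.
apply: (@compact_ind _ K (fun B => F [set f | forall y, B y -> `|Ck_val f y - l y| < e]) cK).
- by move=> B C BC; apply: filterS => f fC y /BC; exact: fC.
- by apply: filterS FH => f _ y [].
- by move=> B C FB FC; apply: filterS (filterI FB FC) => f [fB fC] y [/fB|/fC].
- move=> x Kx; have e4 : 0 < e / 4 by lra.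
  have [U xU UP] := Heq x _ e4; have [V xV VP] := lH x _ e4.
  exists (U `&` V); first exact: filterI.
  apply: filterS (filterI FH (lF x _ e4)) => f [Hf /= fx] y [_ [Uy Vy]].
  have := UP _ _ Hf Uy; have := VP _ Vy; move: fx.
  rewrite !ltr_norml !ler_norml => /andP[? ?] /andP[? ?] /andP[? ?].
  by apply/andP; split; lra.
Qed.

Lemma compact_cvg_seq (T : topologicalType) (x : T) (v : nat -> T) :
  (forall U, nbhs x U -> exists N, forall n, (N <= n)%N -> U (v n)) ->
  compact (x |` range v).
Proof.
move=> vx F FF FA; apply: contrapT => ncl.
have loc y : (x |` range v) y -> exists2 U, nbhs y U & F (~` U).
  move=> Ay; apply: contrapT => nU; apply: ncl; exists y; split => // B V FB yV.
  apply: contrapT => BV; apply: nU; exists V => //.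
  by apply: filterS FB => z Bz Vz; apply: BV; exists z.
have [|U xU FU] := loc x; first by left.
have [N NU] := vx _ xU.
have : F (~` [set z | exists2 n, (n < N)%N & v n = z]).
  elim: N {NU} => [|N IH]; first by apply: filterS FU => z _ [].
  have [|W yW FW] := loc (v N); first by right; exists N.
  apply: filterS (filterI IH FW) => z [zN zW] [n].
  rewrite ltnS leq_eqVlt => /predU1P[->|nN] vz; last by apply: zN; exists n.
  by apply: zW; rewrite -vz; exact: nbhs_singleton.
move=> FN; have [z [[->|[n _ <-]] [nU nN]]] := filter_ex (filterI FA (filterI FU FN)).
  by apply: nU; exact: nbhs_singleton.
have [nN'|Nn] := ltnP n N; first by apply: nN; exists n.
by apply: nU; exact: NU.
Qed.

Definition metrizes (X : topologicalType) (d : X -> X -> RR) : Prop :=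
  pseudometric d /\ forall (x : X) (A : set X), nbhs x A <-> dist_nbhs d x A.

Lemma metrizableP (X : topologicalType) : metrizable X -> exists d : X -> X -> RR, metrizes d.
Proof.
move=> [d [_ [d0 [dC [dT dN]]]]]; exists d; split; last exact: dN.
by split=> // x; apply/d0.
Qed.

Lemma metrizes_dcont (X : topologicalType) (d : X -> X -> RR) (f : X -> RR) :
  metrizes d -> dcont d f <-> continuous f.
Proof.
move=> [pd dN].
by split=> cf x A /cf h; [apply/dN|apply/dN]; exact: h.
Qed.

(* Otherwise points [z i], [w i] converge to a common limit while some [h i] in [A]
   separates them by [e]; then the sum over [i] of
   [i * max 0 (|f (w i) - f (z i)| - e / 2)] is continuous in [f] and unbounded on [A]. *)
Lemma bounded_uniformly_equicontinuous (X : topologicalType) (d : X -> X -> RR)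
    (A : set (Ck X)) (K : set X) (e : RR) :
  metrizes d -> functionally_bounded A -> compact K -> 0 < e ->
  exists2 r : RR, 0 < r & forall f x y, A f -> K x -> d x y < r ->
    `|Ck_val f y - Ck_val f x| <= e.
Proof.
move=> [pd dN] fbA cK e0; apply: contrapT => nr.
have [d0 dC dT] := pd.
have inv_gt0 i : 0 < i.+1%:R^-1 :> RR by rewrite invr_gt0 ltr0n.
have inv_le i j : (i <= j)%N -> j.+1%:R^-1 <= i.+1%:R^-1 :> RR.
  by move=> ij; rewrite lef_pV2 ?posrE ?ltr0n// ler_nat ltnS.
have inv_small (r : RR) : 0 < r -> exists N, forall n, (N <= n)%N -> n.+1%:R^-1 < r.
  move=> r0; have [N NP] := archiR r^-1; exists N => n Nn.
  rewrite invf_plt ?posrE ?ltr0n//; apply: lt_le_trans NP _.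
  by rewrite ler_nat ltnW.
have /choice[c cP] : forall j : nat, exists c : Ck X * X * X,
    [/\ A c.1.1, K c.1.2, d c.1.2 c.2 < j.+1%:R^-1 &
      e < `|Ck_val c.1.1 c.2 - Ck_val c.1.1 c.1.2|].
  move=> j; apply: contrapT => nc; apply: nr; exists j.+1%:R^-1 => // f x y Af Kx xy.
  by rewrite leNgt; apply/negP => h; apply: nc; exists (f, x, y).
(* Only the first points are made to cluster in [K]; the second ones follow, their distance to the
   first being below 1/(j+1). *)
have [x Kx xcl] : exists2 x, K x & forall i, exists2 j, (i <= j)%N & d x (c j).1.2 < i.+1%:R^-1.
  apply: contrapT => ncl.
  have [|||y Ky|N NK] := @compact_ind _ K
    (fun B => exists i, forall j, (i <= j)%N -> ~ B (c j).1.2) cK.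
  - by move=> B C BC [i iP]; exists i => j /iP nC /BC.
  - by exists 0%N => j _ [].  
  - move=> B C [i iP] [j jP]; exists (maxn i j) => k.
    by rewrite geq_max => /andP[/iP nB /jP nC] [].
  - apply: contrapT => nU; apply: ncl; exists y => // i; apply: contrapT => nj.
    apply: nU; exists [set z | d y z < i.+1%:R^-1]; first by apply/dN; exact: dist_nbhs_ball.
    by exists i => j ij [_ /= yj]; apply: nj; exists j.
  - by apply: (NK N (leqnn _)); case: (cP N).
have /choice[j jP] : forall i, exists j, (i <= j)%N /\ d x (c j).1.2 < i.+1%:R^-1.
  by move=> i; have [j] := xcl i; exists j.
pose z i := (c (j i)).1.2; pose w i := (c (j i)).2; pose h i := (c (j i)).1.1.
have zx U : nbhs x U -> exists N, forall n, (N <= n)%N -> U (z n).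
  move=> /dN[r r0 rU]; have [N NP] := inv_small _ r0; exists N => n /NP nr'.
  by apply: rU => /=; apply: lt_trans nr'; case: (jP n).
have wx U : nbhs x U -> exists N, forall n, (N <= n)%N -> U (w n).
  move=> /dN[r r0 rU]; have [|N NP] := inv_small (r / 2); first by lra.
  exists N => n /NP nr'; apply: rU => /=; have [jn xz] := jP n.
  have [_ _ zw _] := cP (j n); have := inv_le _ _ jn.
  have : d x (w n) <= d x (z n) + d (z n) (w n) := dT _ _ _.
  have {}zw : d (z n) (w n) < (j n).+1%:R^-1 := zw.
  have {}xz : d x (z n) < n.+1%:R^-1 := xz.
  move: nr' zw xz; move: (n.+1%:R^-1 : RR) ((j n).+1%:R^-1 : RR) => a b; lra.
(* Two convergent sequences with their limit form a compact set, so closeness on [L] is a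
   neighbourhood in [Ck X]. With tolerance [e / 8], four errors add up to [e / 2], where [u n]
   vanishes. *)
pose L := (x |` range z) `|` (x |` range w).
have cL : compact L by apply: compactU; exact: compact_cvg_seq.
(* The double negations fit the shape [c - k * f] of [continuousR_bump]. *)
pose u i (f : Ck X) := Num.max 0 (- (i%:R * (e / 2)) - (- i%:R) * `|Ck_val f (w i) - Ck_val f (z i)|).
have uc i : continuous (u i).
  apply: continuousR_bump; apply: continuousR_abs; apply: continuousR_add.
    exact: Ck_eval_continuous.
  by apply: continuousR_opp; exact: Ck_eval_continuous.
have uloc (f : Ck X) : exists N, nbhs f [set g | forall n, (N <= n)%N -> u n g = 0].
  have /continuousRP/(_ x (e / 8)) := @Ck_cont _ f.
  have e8 : 0 < e / 8 by lra.
  move=> /(_ e8) xU; have [N NP] := zx _ xU; have [M MP] := wx _ xU.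
  exists (maxn N M); apply/Ck_nbhsP; exists L, (e / 8); split => // g gf n.
  rewrite geq_max => /andP[/NP/= nz /MP/= nw].
  apply: max_l.
  suff : `|Ck_val g (w n) - Ck_val g (z n)| <= e / 2.
    move=> h1; rewrite mulNr opprK addrC subr_le0; exact: ler_wpM2l.
  have gz : `|Ck_val g (z n) - Ck_val f (z n)| < e / 8 by apply: gf; left; right; exists n.
  have gw : `|Ck_val g (w n) - Ck_val f (w n)| < e / 8 by apply: gf; right; right; exists n.
  move: nz nw gz gw; rewrite !ltr_norml !ler_norml.
  move=> /andP[? ?] /andP[? ?] /andP[? ?] /andP[? ?].
  by apply/andP; split; lra.
have [M MP] := fbA _ (lfsum_continuous uc uloc).
have [N MN] := archiR (M * 2 / e).
have [Ah _ _ hN] := cP (j N).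
have := MP _ Ah; apply/negP; rewrite -ltNge.
apply: lt_le_trans (ler_norm _); apply: lt_le_trans (lfsum_nbhs_ge N uloc _); last first.
  by move=> i; rewrite le_max lexx.
rewrite /u lt_max; apply/orP; right.
rewrite mulNr opprK addrC -mulrBr.
have : N%:R * (e / 2) <= N%:R * (`|Ck_val (h N) (w N) - Ck_val (h N) (z N)| - e / 2).
  have {}hN : e < `|Ck_val (h N) (w N) - Ck_val (h N) (z N)| := hN.
  by apply: ler_wpM2l => //; lra.
by move: MN; rewrite ltr_pdivrMr// mulrA; lra.
Qed.

Lemma Ck_bounded_compact (X : topologicalType) (A : set (Ck X)) :
  metrizable X -> closed A -> functionally_bounded A -> compact A.
Proof.
move=> /metrizableP[d dX] clA fbA; apply: Ck_ascoli => // [x|x e e0].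
  have [M MP] := fbA _ (@Ck_eval_continuous X x); by exists M.
have [r r0 rP] := bounded_uniformly_equicontinuous dX fbA (@compact_set1 _ x) e0.
exists [set y | d x y < r]; first by have [_ dN] := dX; apply/dN; exact: dist_nbhs_ball.
by move=> f y Af xy; exact: rP.
Qed.

(** * The Nachbin-Shirota theorem *)

(** The intervals with centre [p n x] and radius [b n x] are nested; [q x] is the supremum of their
    left endpoints. *)
Lemma nested_limit (T : Type) (p b : nat -> T -> RR) :
  (forall n x, 0 <= b n x) ->
  (forall n x, `|p n.+1 x - p n x| + b n.+1 x <= b n x) ->
  exists q, forall n x, `|q x - p n x| <= b n x.
Proof.
move=> b0 pb.
have lo n x k : p n x - b n x <= p (n + k)%N x - b (n + k)%N x.
  elim: k => [|k IH]; first by rewrite addn0.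
  apply: le_trans IH _; rewrite addnS; have := pb (n + k)%N x.
  by have := ler_norm (- (p (n + k).+1 x - p (n + k)%N x)); rewrite normrN; lra.
have hi n x k : p (n + k)%N x + b (n + k)%N x <= p n x + b n x.
  elim: k => [|k IH]; first by rewrite addn0.
  apply: le_trans IH; rewrite addnS; have := pb (n + k)%N x.
  by have := ler_norm (p (n + k).+1 x - p (n + k)%N x); lra.
have lohi m n x : p m x - b m x <= p n x + b n x.
  have := lo m x n; have := hi n x m; rewrite [(n + m)%N]addnC.
  by have := b0 (m + n)%N x; lra.
exists (fun x => sup (range (fun n => p n x - b n x))) => n x.
have : p n x - b n x <= sup (range (fun n => p n x - b n x)).
  by apply: ub_le_sup; [exists (p n x + b n x) => _ [m _ <-]|exists n].
have : sup (range (fun n => p n x - b n x)) <= p n x + b n x.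
  by apply: ge_sup; [exists (p 0%N x - b 0%N x), 0%N|move=> _ [m _ <-]].
by rewrite ler_norml; move=> ? ?; apply/andP; split; lra.
Qed.

(** Near [x] the weight stays below [w x + 1], so the convergence is locally uniform. *)
Lemma weighted_limit_continuous (T : topologicalType) (p : nat -> T -> RR)
    (c : nat -> RR) (w q : T -> RR) :
  (forall n, continuous (p n)) -> continuous w -> (forall x, 0 <= w x) ->
  (forall e : RR, 0 < e -> exists n, c n < e) ->
  (forall n x, `|q x - p n x| <= c n * w x) -> continuous q.
Proof.
move=> cp cw w0 c0 qp; apply/continuousRP => x e e0.
have wx1 : 0 < w x + 1 by have := w0 x; lra.
have [|n cn] := c0 (e / 3 / (w x + 1)); first by rewrite !divr_gt0.
have e3 : 0 < e / 3 by lra.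
have /continuousRP/(_ x (e / 3) e3) := cp n.
have /continuousRP/(_ x 1 ltr01) := cw.
move=> wx px; apply: filterS (filterI wx px) => y [/= wy py].
have cw' z : w z < w x + 1 -> c n * w z < e / 3.
  move=> wz; have [cn0|cn0] := leP (c n) 0; first by have := w0 z; nra.
  apply: le_lt_trans (_ : c n * (w x + 1) < _); first by rewrite ler_pM2l// ltW.
  by move: cn; rewrite ltr_pdivlMr.
have := qp n x; have := qp n y.
have := cw' x _; have := cw' y _.
move: py wy; rewrite !ltr_norml !ler_norml => /andP[? ?] /andP[? ?] hy hx.
have {}hx := hx ltac:(lra); have {}hy := hy ltac:(lra).
by move=> /andP[? ?] /andP[? ?]; apply/andP; split; lra.
Qed.

Lemma continuousR_min (T : topologicalType) (f g : T -> RR) :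
  continuous f -> continuous g -> continuous (fun x => Num.min (f x) (g x)).
Proof.
move=> cf cg; rewrite (_ : (fun _ => _) = fun x => - Num.max (- f x) (- g x)).
  by apply: continuousR_opp; apply: continuousR_max; exact: continuousR_opp.
by apply/funext => x; rewrite oppr_max !opprK.
Qed.

Section NachbinShirota.
Context {Y : topologicalType} (S : set (Y -> RR)).
Hypothesis S_closed : forall f : Y -> RR, continuous f ->
  (forall (K : set Y) (e : RR), compact K -> 0 < e ->
     exists2 g, S g & forall y, K y -> `|g y - f y| < e) -> S f.
Hypothesis S_convex : forall (a b : RR) f g, `|a| + `|b| <= 1 -> S f -> S g ->
  S (fun y => a * f y + b * g y).
Hypothesis S_absorbing : forall f : Y -> RR, continuous f ->
  exists2 r : RR, 0 < r & forall t : RR, `|t| <= r -> S (fun y => t * f y).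

Let S_half (f g : Y -> RR) : S (fun y => 2 * f y) -> S (fun y => 2 * g y) ->
  S (fun y => f y + g y).
Proof.
move=> Sf Sg.
rewrite (_ : (fun _ => _) = fun y => (1/2) * (2 * f y) + (1/2) * (2 * g y)).
  by apply: S_convex => //; rewrite ger0_norm; lra.
by apply/funext => y; lra.
Qed.

(** A gliding hump. If adding and subtracting the hump both landed in [n.+1] times [S], absolute
    convexity would put the bad [f] in [S]; so one sign fails. Closedness of [S] then gives a
    compact set and a tolerance on which the failure persists for every [q] near [p']. *)
Let gliding_step (w : Y -> RR) (n : nat) (p : Y -> RR) (c : RR) :
  continuous w -> (forall y, 1 <= w y) ->
  (forall r : RR, 0 < r -> exists f : Y -> RR, [/\ continuous f, forall y, `|f y| <= r * w y & ~ S f]) ->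
  continuous p -> 0 < c ->
  exists (p' : Y -> RR) c', [/\ continuous p', 0 < c', c' <= c / 2,
    forall y, `|p' y - p y| + c' * w y <= c * w y &
    forall q : Y -> RR, continuous q -> (forall y, `|q y - p' y| <= c' * w y) ->
      ~ S (fun y => n.+1%:R^-1 * q y)].
Proof.
move=> cw w1 bad cp c0.
have m0 : 0 < n.+1%:R :> RR by rewrite ltr0n.
have m1 : 1 <= n.+1%:R :> RR by rewrite ler1n.
(* The hump is [2 * n.+1 * f], so this bound makes it cost half of the budget [c * w]; the other
   half is left for [c']. *)
have [|f [cf fw nSf]] := bad (c / 4 / n.+1%:R); first by rewrite !divr_gt0.
have [s s1 nSs] : exists2 s : RR, `|s| = 1 &
    ~ S (fun y => n.+1%:R^-1 * (p y + s * (2 * n.+1%:R * f y))).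
  apply: contrapT => nex.
  have Sall (s : RR) : `|s| = 1 -> S (fun y => n.+1%:R^-1 * (p y + s * (2 * n.+1%:R * f y))).
    by move=> s1; apply: contrapT => nS; apply: nex; exists s.
  apply: nSf.
  rewrite (_ : f = fun y => (1/4) * (n.+1%:R^-1 * (p y + 1 * (2 * n.+1%:R * f y)))
     + (- (1/4)) * (n.+1%:R^-1 * (p y + (-1) * (2 * n.+1%:R * f y)))).
    by apply: S_convex; [rewrite normrN ger0_norm; lra|apply: Sall; rewrite normr1
      |apply: Sall; rewrite normrN1].
  by apply/funext => y; field; rewrite ?gt_eqF.
pose p' y := p y + s * (2 * n.+1%:R * f y).
have cp' : continuous p'.
  by apply: continuousR_add => //; do 2 apply: continuousR_scale.
have [K [e [cK e0 Ke]]] : exists (K : set Y) (e : RR), [/\ compact K, 0 < e &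
    forall g, S g -> ~ (forall y, K y -> `|g y - n.+1%:R^-1 * p' y| < e)].
  apply: contrapT => nK; apply: nSs; apply: S_closed; first exact: continuousR_scale.
  move=> K e cK e0; apply: contrapT => ng; apply: nK; exists K, e; split => // g Sg h.
  by apply: ng; exists g.
have [M MP] := continuous_bounded_compact cK cw.
have M0 : 0 < `|M| + 1 by have := normr_ge0 M; lra.
(* On [K] the weight is at most [|M| + 1], so the second term keeps [c' * w] below [e] there. *)
exists p', (Num.min (c / 2) (e / (`|M| + 1) / 2)); split => //.
- by rewrite lt_min !divr_gt0.
- by rewrite ge_min lexx.
- move=> y; rewrite /p' addrAC subrr add0r.
  have -> : `|s * (2 * n.+1%:R * f y)| = 2 * n.+1%:R * `|f y|.
    by rewrite normrM s1 mul1r normrM (@ger0_norm _ (2 * _)) ?mulr_ge0.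
  have : 2 * n.+1%:R * `|f y| <= c / 2 * w y.
    have -> : c / 2 * w y = 2 * n.+1%:R * (c / 4 / n.+1%:R * w y).
      by field; rewrite gt_eqF.
    by rewrite ler_wpM2l// mulr_ge0.
  have : Num.min (c / 2) (e / (`|M| + 1) / 2) * w y <= c / 2 * w y.
    by apply: ler_wpM2r; [have := w1 y; lra|rewrite ge_min lexx].
  by lra.
- move=> q cq qp' Sq; apply: (Ke _ Sq) => y Ky.
  rewrite -mulrBr normrM ger0_norm ?invr_ge0//.
  apply: le_lt_trans (_ : `|q y - p' y| < e).
    by rewrite ler_piMl// invf_le1.
  apply: le_lt_trans (qp' y) _.
  have wM : w y <= `|M| + 1.
    by have := ler_norm (w y); have := MP y Ky; have := ler_norm M; lra.
  apply: le_lt_trans (_ : (e / (`|M| + 1) / 2) * (`|M| + 1) < _).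
    apply: ler_pM => //; last by rewrite ge_min lexx orbT.
      by rewrite le_min !divr_ge0// ltW.
    by have := w1 y; lra.
  rewrite (_ : _ * _ = e / 2); first by lra.
  by field; rewrite gt_eqF.
Qed.

(** Otherwise the humps lead to a continuous limit [q] with [q / n.+1] outside [S] for every [n],
    against absorption. Unbounded weights are allowed because they will force the support of [S] to
    be functionally bounded. *)
Lemma barrel_absorbs_weighted (w : Y -> RR) : continuous w -> (forall y, 1 <= w y) ->
  exists2 r : RR, 0 < r & forall f : Y -> RR, continuous f -> (forall y, `|f y| <= r * w y) -> S f.
Proof.
move=> cw w1; apply: contrapT => nr.
have bad (r : RR) : 0 < r -> exists f : Y -> RR, [/\ continuous f, forall y, `|f y| <= r * w y & ~ S f].
  move=> r0; apply: contrapT => nf; apply: nr; exists r => // f cf fw.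
  by apply: contrapT => nSf; apply: nf; exists f.
pose St := {pc : (Y -> RR) * RR | continuous pc.1 /\ 0 < pc.2}.
have step n (x : St) : exists y : St, [/\ (sval y).2 <= (sval x).2 / 2,
    forall z, `|(sval y).1 z - (sval x).1 z| + (sval y).2 * w z <= (sval x).2 * w z &
    forall q : Y -> RR, continuous q -> (forall z, `|q z - (sval y).1 z| <= (sval y).2 * w z) ->
      ~ S (fun z => n.+1%:R^-1 * q z)].
  case: x => -[p c] [/= cp c0].
  have [p' [c' [cp' c'0 c'c pp' p'S]]] := gliding_step n cw w1 bad cp c0.
  by exists (exist _ (p', c') (conj cp' c'0)).
have /choice[F FP] : forall nx : nat * St, exists y : St, [/\ (sval y).2 <= (sval nx.2).2 / 2,
    forall z, `|(sval y).1 z - (sval nx.2).1 z| + (sval y).2 * w z <= (sval nx.2).2 * w z &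
    forall q : Y -> RR, continuous q -> (forall z, `|q z - (sval y).1 z| <= (sval y).2 * w z) ->
      ~ S (fun z => nx.1.+1%:R^-1 * q z)].
  by move=> [n x]; exact: step.
have x0 : St.
  by exists (fun _ => 0, 1); split => //=; exact: continuousR_cst.
pose L := fix L n := if n is n'.+1 then F (n', L n') else x0.
pose p n := (sval (L n)).1; pose c n := (sval (L n)).2.
have cp n : continuous (p n) by case: (svalP (L n)).
have c0 n : 0 < c n by case: (svalP (L n)).
have chalf n : c n.+1 <= c n / 2 by case: (FP (n, L n)).
have [q qp] : exists q, forall n x, `|q x - p n x| <= c n * w x.
  apply: nested_limit => [n x|n x].
    by rewrite mulr_ge0 ?(ltW (c0 n))//; have := w1 x; lra.
  by have [_ h _] := FP (n, L n); exact: h.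
have csmall (e : RR) : 0 < e -> exists n, c n < e.
  move=> e0; have [n cn] := archiR (c 0%N / e).
  exists n; have : c n * n.+1%:R <= c 0%N.
    elim: n {cn} => [|n IH]; first by rewrite mulr1.
    apply: le_trans IH; have := chalf n; have := c0 n.
    have : 1 <= n.+1%:R :> RR by rewrite ler1n.
    rewrite -[n.+2%:R]natr1; nra.
  move: cn; rewrite ltr_pdivrMr// => cn ccn.
  have nn : n%:R < n.+1%:R :> RR by rewrite ltr_nat.
  rewrite -(@ltr_pM2r _ n.+1%:R) ?ltr0n//.
  by have := c0 n; nra.
have cq : continuous q.
  by apply: (weighted_limit_continuous cp cw _ csmall qp) => y; have := w1 y; lra.
have [r r0 rS] := S_absorbing cq.
have [n rn] := archiR r^-1.
have [_ _ nS] := FP (n, L n); apply: (nS q cq (qp n.+1)) => /=; apply: rS.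
rewrite ger0_norm ?invr_ge0// invf_ple ?posrE ?ltr0n//.
by apply/ltW; apply: lt_trans rn _; rewrite ltr_nat.
Qed.

(** The support of the barrel [S]: near a point off it, [S] contains a whole linear space of
    functions. *)
Let supp : set Y :=
  [set y | forall U, nbhs y U -> exists f : Y -> RR,
     [/\ continuous f, forall z, ~ U z -> f z = 0 & ~ S f]].

Let supp_closed : closed supp.
Proof.
move=> y cly U /= yU.
have [z [sz Uz]] := cly _ (nbhs_interior yU).
exact: sz.
Qed.

(** Functions [h k] outside [S] can be found near levels of [|f|] tending to infinity, so [1] plus
    the sum of the [k * |h k|] is a continuous weight. If [S] absorbs it with radius [r], then [h k]
    lies in [S] as soon as [k > 1 / r]. *)
Let supp_bounded : functionally_bounded supp.
Proof.
move=> f cf; apply: contrapT => /unbounded_seq[y [sy ky]].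
pose fn (x : Y) : RR := `|f x|; have cn : continuous fn by exact: continuousR_abs.
have /choice[h hP] k : exists h, [/\ continuous h,
    forall z, ~ [set x | `|fn x - fn (y k)| < 1 / 2] z -> h z = 0 :> RR & ~ S h].
  apply: sy; apply: ((continuousRP fn).1 cn); lra.
pose u k x := k%:R * `|h k x|.
have uc k : continuous (u k).
  by apply: continuousR_scale; apply: continuousR_abs; case: (hP k).
have uloc (t : Y) : exists N, nbhs t [set s | forall n, (N <= n)%N -> u n s = 0].
  apply: (@level_locfin _ _ _ fn (fun k => fn (y k))) => //; first exact: cn.
  move=> k s h1; rewrite /u; have [_ hk _] := hP k; rewrite hk ?normr0 ?mulr0 //= => h2.
  by move: h1; rewrite leNgt h2.
have u0 k x : 0 <= u k x by rewrite mulr_ge0.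
have wc : continuous (fun x => 1 + lfsum u x).
  by apply: continuousR_add; [exact: continuousR_cst|exact: lfsum_continuous].
have [x|r r0 rS] := barrel_absorbs_weighted wc.
  have [N uN] := uloc x; rewrite lerDl; apply: (lfsum_ge0 _ uN) => // A.
  exact: nbhs_singleton.
have [k rk] := archiR r^-1.
have [ch _ nSh] := hP k; apply: nSh; apply: rS => // x.
have : u k x <= lfsum u x by exact: lfsum_nbhs_ge.
rewrite /u => h1.
have : `|h k x| <= r * (k%:R * `|h k x|).
  rewrite mulrA ler_peMl// -[X in X <= _](@mulfV _ r) ?gt_eqF// ler_pM2l//.
  exact: ltW.
by have := ler_wpM2l (ltW r0) h1; lra.
Qed.

(** As [S] is closed, it suffices to match [f] on a compact [C]. Off the support, finitely many
    bumps add up to a [v] all of whose continuous multiples lie in [S], with [v >= 1 / 2] at the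
    points of [C] where [f] is nonzero; on [C], [f] is such a multiple. *)
Lemma barrel_contains_vanishing : bumps Y -> forall f : Y -> RR, continuous f ->
  (forall y, supp y -> nbhs y [set z | f z = 0]) -> S f.
Proof.
move=> bY f cf f0; apply: S_closed => // C e cC e0.
pose D := closure [set y | f y != 0].
have cD : compact (C `&` D) by apply: compact_closedI => //; exact: closed_closure.
(* Quantifying over all multipliers [h] makes the property additive in [v]: the factor 2 demanded by
   [S_half] is absorbed in [h]. *)
have [|||y [Cy Dy]|v [cv v0 vD Sv]] := @compact_ind _ _ (fun B => exists v : Y -> RR,
    [/\ continuous v, forall y, 0 <= v y, forall y, B y -> 1 / 2 <= v y &
      forall h : Y -> RR, continuous h -> S (fun y => h y * v y)]) cD.
- by move=> A B AB [v [cv v0 vB Sv]]; exists v; split => // y /AB; exact: vB.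
- exists (fun _ => 0); split => //; first exact: continuousR_cst.
  move=> h ch; have [r r0 rS] := S_absorbing ch.
  rewrite (_ : (fun _ => _) = fun y => 0 * h y).
    by apply: rS; rewrite normr0 ltW.
  by apply/funext => y; rewrite mulr0 mul0r.
- move=> A B [v [cv v0 vA Sv]] [w [cw w0 wB Sw]]; exists (fun y => v y + w y); split.
  + exact: continuousR_add.
  + by move=> y; rewrite addr_ge0.
  + by move=> y [/vA|/wB]; have := v0 y; have := w0 y; lra.
  + move=> h ch; rewrite (_ : (fun _ => _) = fun y => h y * v y + h y * w y).
      apply: S_half.
        rewrite (_ : (fun _ => _) = fun y => 2 * h y * v y).
          by apply: Sv; exact: continuousR_scale.
        by apply/funext => y; rewrite mulrA.
      rewrite (_ : (fun _ => _) = fun y => 2 * h y * w y).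
        by apply: Sw; exact: continuousR_scale.
      by apply/funext => y; rewrite mulrA.
    by apply/funext => y; rewrite mulrDr.
- have nsy : ~ supp y.
    by move=> /f0 y0; have [z [/= /eqP nz]] := Dy _ y0.
  have [U yU US] : exists2 U, nbhs y U & forall h : Y -> RR, continuous h ->
      (forall z, ~ U z -> h z = 0) -> S h.
    apply: contrapT => nU; apply: nsy => U yU; apply: contrapT => nh.
    apply: nU; exists U => // h ch hU; apply: contrapT => nSh; apply: nh.
    by exists h.
  have [u [cu u0 uy uU]] := bY _ _ yU.
  exists [set z | `|u z - u y| < 1 / 2].
    by apply: ((continuousRP u).1 cu); lra.
  exists u; split => //.
    by move=> z [_ /=]; rewrite uy ltr_norml => /andP[]; lra.
  move=> h ch; apply: US; first exact: continuousR_mul.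
  by move=> z /uU ->; rewrite mulr0.
have mx0 y : Num.max (v y) (1/2) != 0.
  by rewrite gt_eqF// lt_max; apply/orP; right; lra.
(* The maximum keeps the quotient continuous everywhere, and it equals [v] where [f] is nonzero on
   [C]. *)
exists (fun y => (f y / Num.max (v y) (1/2)) * v y).
  apply: Sv; apply: continuousR_mul => //; apply: continuousR_inv => //.
  by apply: continuousR_max => //; exact: continuousR_cst.
move=> y Cy; have [fy0|fy] := eqVneq (f y) 0.
  by rewrite fy0 !mul0r subrr normr0.
have vy : 1 / 2 <= v y by apply: vD; split => //; exact: subset_closure.
rewrite max_l// mulfVK ?subrr ?normr0//.
by rewrite gt_eqF//; lra.
Qed.

(** The compact set is the support. With [g] the truncation of [f] at [r / 2], [2 * g] is bounded by
    [r], and [f - g] vanishes near the support as soon as [|f| < r / 2] on it. *)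
Lemma barrel_nbhs0 : bumps Y ->
  (forall A : set Y, closed A -> functionally_bounded A -> compact A) ->
  exists (K : set Y) (e : RR), [/\ compact K, 0 < e &
    forall f : Y -> RR, continuous f -> (forall y, K y -> `|f y| < e) -> S f].
Proof.
move=> bY cpt.
have [|y|r r0 rS] := @barrel_absorbs_weighted (fun _ => 1); [exact: continuousR_cst|by []|].
have cs := cpt _ supp_closed supp_bounded.
exists supp, (r / 2); split => //; first by lra.
move=> f cf fs.
pose g y := Num.max (- (r / 2)) (Num.min (f y) (r / 2)).
have cg : continuous g.
  apply: continuousR_max; first exact: continuousR_cst.
  by apply: continuousR_min => //; exact: continuousR_cst.
have gr y : `|g y| <= r / 2.
  rewrite ler_norml le_max lexx/= ge_max ge_min lexx orbT andbT; lra.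
have gf y : `|f y| < r / 2 -> g y = f y.
  rewrite ltr_norml => /andP[f1 f2]; rewrite /g min_l; last exact: ltW.
  by rewrite max_r// ltW.
rewrite (_ : f = fun y => g y + (f y - g y)); last by apply/funext => y; rewrite addrC subrK.
apply: S_half.
  apply: rS; first exact: continuousR_scale.
  by move=> y; rewrite normrM ger0_norm//; have := gr y; lra.
apply: barrel_contains_vanishing => //.
  by apply: continuousR_scale; apply: continuousR_add => //; exact: continuousR_opp.
move=> y sy; have fy := fs _ sy.
have /continuousRP/(_ y (r / 2 - `|f y|)) := continuousR_abs cf.
rewrite subr_gt0 => /(_ fy); apply: filterS => z /=; rewrite ltr_norml => /andP[_ h].
by rewrite gf ?subrr ?mulr0//; lra.
Qed.

End NachbinShirota.

Lemma Ck_barrelled (Y : topologicalType) : bumps Y ->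
  (forall A : set Y, closed A -> functionally_bounded A -> compact A) ->
  barrelled (@Ck_val Y).
Proof.
move=> bY cpt A [clA [convA absA]].
pose S : set (Y -> RR) := [set f | exists2 z : Ck Y, A z & Ck_val z = f].
have [||||//|K [e [cK e0 KS]]] := @barrel_nbhs0 Y S.
- move=> f cf fS; exists (Ckm cf) => //; apply: clA => B /Ck_nbhsP[K [e [cK e0 KB]]].
  have [_ [z Az <-] zf] := fS K e cK e0.
  by exists z; split => //; apply: KB.
- move=> a b _ _ ab [x Ax <-] [y Ay <-].
  have cz : continuous (fun t => a * Ck_val x t + b * Ck_val y t).
    by apply: continuousR_add; apply: continuousR_scale; exact: Ck_cont.
  by exists (Ckm cz) => //; apply: (convA a b x y).
- move=> f cf; have [r r0 rA] := absA (Ckm cf).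
  exists r => // t tr; exists (Ckm (continuousR_scale (c := t) cf)) => //.
  exact: (rA t (Ckm cf)).
- by [].
exists (Ckm (@continuousR_cst Y 0)); split => //.
apply/Ck_nbhsP; exists K, e; split => // g gK.
have [|z Az zg] := KS (Ck_val g) (@Ck_cont _ g).
  by move=> y /gK; rewrite Ckm_val subr0.
suff -> : g = z by [].
by apply: Ck_inj => y; rewrite zg.
Qed.

(** * Resolutions obtained from G-bases *)

Lemma dominating_family (T : Type) (C : set (T -> RR))
    (P : (nat -> nat) -> set (T -> RR)) :
  (forall a b, leNN a b -> P a `<=` P b) ->
  (forall a x, exists M : RR, forall f, P a f -> f x <= M) ->
  (forall f, C f -> exists a, P a f) ->
  exists g : (nat -> nat) -> T -> RR,
    (forall a b x, leNN a b -> g a x <= g b x) /\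
    forall f, C f -> exists a, forall x, f x <= g a x.
Proof.
move=> Pmono Pbd Pdom; pose A a x := [set f x | f in P a] `|` [set 0].
have Aub a x : has_ubound (A a x).
  have [M MP] := Pbd a x; exists (Num.max M 0) => _ [[f Pf <-]|->].
    by rewrite le_max MP.
  by rewrite le_max lexx orbT.
exists (fun a x => sup (A a x)); split.
  move=> a b x ab; apply: ge_sup; first by exists 0; right.
  move=> _ [[f Pf <-]|->]; apply: ub_le_sup => //; last by right.
  by left; exists f => //; exact: Pmono Pf.
move=> f /Pdom[a Pf]; exists a => x; apply: ub_le_sup => //.
by left; exists f.
Qed.

Lemma nbhs0_eval (Y : topologicalType) (y : Y) :
  nbhs0 (@Ck_val Y) [set f | `|Ck_val f y| < 1].
Proof.
exists (Ckm (@continuousR_cst Y 0)); split => //; apply/Ck_nbhsP; exists [set y], 1.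
split => //; first exact: compact_set1.
by move=> f /(_ y erefl); rewrite Ckm_val subr0.
Qed.

Lemma nbhs0_CkP (Y : topologicalType) (U : set (Ck Y)) : nbhs0 (@Ck_val Y) U ->
  exists (K : set Y) (e : RR), [/\ compact K, 0 < e &
    forall g : Ck Y, (forall y, K y -> `|Ck_val g y| < e) -> U g].
Proof.
move=> [z [z0 /Ck_nbhsP[K [e [cK e0 KU]]]]]; exists K, e; split => // g gK.
by apply: KU => y /gK; rewrite z0 subr0.
Qed.

(** The bound at [x]: [U a] contains every [phi] vanishing on some compact [K], and [|h x| <= M] for
    [h] in [K]. The function [max 0 (|h x| - M)] of [h] is such a [phi], whence [|h x| <= M + 1] on
    the polar. *)
Lemma CkCk_Gbase_dominating (X : topologicalType) : has_Gbase (@CkCk_val X) ->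
  exists g : (nat -> nat) -> X -> RR,
    (forall a b x, leNN a b -> g a x <= g b x) /\
    forall f, continuous f -> exists a, forall x, f x <= g a x.
Proof.
move=> [U [U0 [Ucof Umono]]].
apply: (@dominating_family X [set f | continuous f]
  (fun a => [set f | exists2 h : Ck X, Ck_val h = f &
     forall phi : CkCk X, U a phi -> `|CkCk_val phi h| <= 1])).
- move=> a b ab f [h hf hU]; exists h => // phi Ub; apply: hU; exact: Umono Ub.
- move=> a x; have [K [e [cK e0 KU]]] := @nbhs0_CkP (Ck X) _ (U0 a).
  have [M MP] := continuous_bounded_compact cK (@Ck_eval_continuous X x).
  have cphi : continuous (fun h : Ck X => Num.max 0 (- M - (-1) * `|Ck_val h x|)).
    by apply: continuousR_bump; apply: continuousR_abs; exact: Ck_eval_continuous.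
  exists (M + 1) => _ [h <- /(_ (Ckm cphi))]; rewrite /CkCk_val Ckm_val => hU.
  have {hU} : `|Num.max 0 (- M - (-1) * `|Ck_val h x|)| <= 1.
    apply: hU; apply: KU => f Kf; rewrite Ckm_val max_l ?normr0//.
    by have := MP _ Kf; lra.
  by rewrite ger0_norm ?le_max ?lexx// ge_max => /andP[_]; have := ler_norm (Ck_val h x); lra.
- move=> f cf; have [a Ua] := Ucof _ (@nbhs0_eval (Ck X) (Ckm cf)).
  by exists a, (Ckm cf) => // phi /Ua /ltW.
Qed.

Lemma Ck_set1_bounded (Y : topologicalType) (f : Ck Y) :
  tvs_bounded (@Ck_val Y) [set f].
Proof.
move=> U /nbhs0_CkP[K [e [cK e0 KU]]].
have [M MP] := continuous_bounded_compact cK (@Ck_cont _ f).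
have M0 : 0 < `|M| + 1 by have := normr_ge0 M; lra.
exists (e / 2 / (`|M| + 1)); first by rewrite !divr_gt0.
move=> t _ z tr -> zt; apply: KU => y Ky; rewrite zt normrM.
apply: le_lt_trans (_ : e / 2 < e); last by lra.
have -> : e / 2 = e / 2 / (`|M| + 1) * (`|M| + 1) by rewrite divfK ?gt_eqF.
apply: ler_pM => //.
by have := MP _ Ky; have := ler_norm M; lra.
Qed.

Lemma scaled_eval_tdual (Y : topologicalType) (c : RR) (y : Y) :
  tdual (@Ck_val Y) (fun f => c * Ck_val f y).
Proof.
split; first by apply: continuousR_scale; exact: Ck_eval_continuous.
by move=> a b f g h /(_ y) ->; ring.
Qed.

(** The bound at [y]: the bounded set [B] is absorbed by the functions with [|f y| < 1], so [e * r]
    times the evaluation at [y] lies in [W a], which bounds [h y] by [(e * r)^-1]. *)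
Lemma strong_Gbase_dominating (Y : topologicalType) :
  strong_dual_has_Gbase (@Ck_val Y) ->
  exists g : (nat -> nat) -> Y -> RR,
    (forall a b x, leNN a b -> g a x <= g b x) /\
    forall f, continuous f -> exists a, forall x, f x <= g a x.
Proof.
move=> [W [W0 [Wcof Wmono]]].
apply: (@dominating_family Y [set f | continuous f]
  (fun a => [set f | exists2 h : Ck Y, Ck_val h = f &
     forall xi : Ck Y -> RR, W a xi -> `|xi h| <= 1])).
- move=> a b ab f [h hf hW]; exists h => // xi Wb; apply: hW; exact: Wmono Wb.
- move=> a y; have [_ [B [e [bB e0 BW]]]] := W0 a.
  have [r r0 rP] := bB _ (nbhs0_eval y).
  exists (e * r)^-1 => _ [h <- hW].
  have {hW} : `|e * r * Ck_val h y| <= 1.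
    apply: (hW (fun f => e * r * Ck_val f y)); apply: BW; split.
      exact: scaled_eval_tdual.
    move=> f Bf; have := rP r f (Ckm (continuousR_scale (c := r) (@Ck_cont _ f))).
    rewrite /= Ckm_val => /(_ _ Bf _)/ltW h1.
    rewrite -mulrA normrM (ger0_norm (ltW e0)) ler_piMr ?(ltW e0)//.
    by apply: h1 => //; rewrite ger0_norm ?(ltW r0).
  rewrite normrM ger0_norm ?mulr_ge0 ?(ltW e0) ?(ltW r0)// => h1.
  apply: le_trans (ler_norm _) _; rewrite -[X in _ <= X]mul1r ler_pdivlMr ?mulr_gt0//.
  by rewrite mulrC.
- move=> f cf.
  have [|a aW] := Wcof [set xi | tdual (@Ck_val Y) xi /\ `|xi (Ckm cf)| <= 1].
    split; first by move=> xi [].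
    exists [set (Ckm cf)], 1; split => //; first exact: Ck_set1_bounded.
    by move=> xi [txi xi1]; split => //; exact: xi1.
  by exists a, (Ckm cf) => // xi /aW[].
Qed.

Lemma bounded_resolution_strong_Gbase (T : Type) (V : topologicalType)
    (v : V -> T -> RR) (B : (nat -> nat) -> set V) :
  (forall a, tvs_bounded v (B a)) -> (forall a b, leNN a b -> B a `<=` B b) ->
  (forall A, tvs_bounded v A -> exists a, A `<=` B a) ->
  strong_dual_has_Gbase v.
Proof.
move=> bB Bmono Bcof.
exists (fun a => [set phi | tdual v phi /\ forall x, B a x -> `|phi x| <= (a 0%N).+1%:R^-1]).
split; last split.
- move=> a; split; first by move=> phi [].
  by exists (B a), (a 0%N).+1%:R^-1; split => //; rewrite invr_gt0 ltr0n.
- move=> W [Wd [A [e [bA e0 AW]]]]; have [a Aa] := Bcof _ bA.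
  have [n en] := archiR e^-1.
  (* Coordinate 0 also sets the tolerance, so raising it alone reaches the precision [e] while [B a]
     stays inside [B b]. *)
  pose b i := if i is 0%N then maxn (a 0%N) n else a i.
  have ab : leNN a b by move=> [|i] /=; rewrite ?leq_maxl.
  exists b => phi [dphi phiB]; apply: AW; split => // x Ax.
  apply: le_trans (phiB _ (Bmono _ _ ab _ (Aa _ Ax))) _.
  rewrite invf_ple ?posrE ?ltr0n//; apply: le_trans (ltW en) _.
  by rewrite ler_nat /b leqW// leq_maxr.
- move=> a b ba phi [dphi phiB]; split => // x Bx.
  apply: le_trans (phiB _ (Bmono _ _ ba _ Bx)) _.
  by rewrite lef_pV2 ?posrE ?ltr0n// ler_nat ltnS; exact: ba.
Qed.

(** From an infinite open set a nonempty open piece is split off so that an infinite open set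
    disjoint from it remains. Iteration gives disjoint open sets, each supporting a bump capped at
    1. *)
Lemma infinite_discrete_bumps (X : topologicalType) :
  tychonoff_space X -> infinite_set [set: X] ->
  exists (x : nat -> X) (e : nat -> X -> RR), [/\ forall k, continuous (e k),
    forall k y, 0 <= e k y <= 1, forall k, e k (x k) = 1 &
    forall j k, j != k -> e k (x j) = 0].
Proof.
move=> tyX infX; have hX : hausdorff_space X by case: tyX.
have closed_finite (A : set X) : finite_set A -> closed A.
  by move: A; apply/accessible_finite_set_closed; exact: hausdorff_accessible.
pose St := {W : set X | open W /\ infinite_set W}.
pose mk W (oW : open W) (iW : infinite_set W) : St := exist _ W (conj oW iW).
have step (W : St) : exists UW : set X * St, [/\ open UW.1, UW.1 !=set0,
    UW.1 `<=` sval W, sval UW.2 `<=` sval W & UW.1 `&` sval UW.2 = set0].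
  case: W => W [oW infW] /=.
  have [x Wx] := infinite_setN0 infW.
  have [y [Wy yx]] : exists y, W y /\ y <> x.
    apply: contrapT => ny; apply: infW; apply: (@sub_finite_set _ _ [set x]).
      by move=> y Wy; apply: contrapT => yx; apply: ny; exists y.
    exact: finite_set1.
  move: hX; rewrite open_hausdorff => /(_ y x); case=> [|[A B] /= [Ay Bx] [oA oB /eqP AB]].
    exact/eqP.
  rewrite !inE in Ay Bx.
  (* If what remains off the closure of [W] meet [B] is infinite, [W] meet [B] is split off. If it
     is finite, so is [W] meet [A]; then [y] is isolated and its singleton is split off. *)
  have [fin|inf] := pselect (finite_set (W `&` ~` closure (W `&` B))).
    have finA : finite_set (W `&` A).
      apply: sub_finite_set fin => z [Wz Az]; split => // clz.
      have [t [[_ Bt] At]] := clz _ (open_nbhs_nbhs (conj oA Az)).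
      by have : (A `&` B) t by []; rewrite AB.
    have oy : open [set y].
      rewrite (_ : [set y] = (W `&` A) `&` ~` ((W `&` A) `&` ~` [set y])).
        apply: openI; first exact: openI.
        by apply: closed_openC; apply: closed_finite; apply: sub_finite_set finA => z [].
      apply/seteqP; split => [z -> /=|z [[Wz Az] nz]]; first by split => // -[_]; exact.
      by apply: contrapT => zy; apply: nz.
    have oW' : open (W `&` ~` [set y]).
      by apply: openI => //; apply: closed_openC; apply: closed_finite; exact: finite_set1.
    have infW' : infinite_set (W `&` ~` [set y]).
      by apply: infinite_setD => //; exact: finite_set1.
    exists ([set y], mk _ oW' infW'); split => /=.
    - exact: oy.
    - by exists y.
    - by move=> z ->.
    - by move=> z [].
    - by rewrite -subset0 => z [-> [_ zy]]; exact: zy.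
  have oW' : open (W `&` ~` closure (W `&` B)).
    by apply: openI => //; apply: closed_openC; exact: closed_closure.
  exists (W `&` B, mk _ oW' inf); split => /=.
  - exact: openI.
  - by exists x.
  - by move=> z [].
  - by move=> z [].
  - by rewrite -subset0 => z [h [_]]; apply; exact: subset_closure.
have [F FP] := choice step.
pose L := fix L n := if n is n'.+1 then (F (L n')).2 else mk _ openT infX.
pose U n := (F (L n)).1.
have Lmono j k : (j <= k)%N -> sval (L k) `<=` sval (L j).
  move=> /subnKC <-; elim: (k - j)%N => [|i IH]; first by rewrite addn0.
  by rewrite addnS; apply: subset_trans IH; have [_ _ _] := FP (L (j + i)%N).
have Udisj j k : (j < k)%N -> U j `&` U k = set0.
  move=> jk; rewrite -subset0 => z [Uj Uk].
  have [_ _ _ _ jd] := FP (L j); have [_ _ Ukk _ _] := FP (L k).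
  by rewrite -jd; split => //; exact: (Lmono j.+1 k jk _ (Ukk _ Uk)).
have /choice[x xU] k : exists x, U k x by have [_ [x Ux] _ _ _] := FP (L k); exists x.
have /choice[u uP] k : exists u : X -> RR, [/\ continuous u, forall y, 0 <= u y, u (x k) = 1 &
    forall y, ~ U k y -> u y = 0].
  apply: tychonoff_bump => //; apply: open_nbhs_nbhs; split => //.
  by have [] := FP (L k).
exists x, (fun k y => Num.min (u k y) 1); split.
- by move=> k; apply: continuousR_min; [case: (uP k)|exact: continuousR_cst].
- move=> k y; have [_ u0 _ _] := uP k.
  by rewrite le_min u0 ge_min lexx orbT ler01.
- by move=> k; have [_ _ -> _] := uP k; rewrite minxx.
- move=> j k jk; have [_ _ _ ->] := uP k; first by rewrite min_l.
  move=> Ukj; have : (U j `&` U k) (x j) by [].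
  by move: jk; rewrite neq_ltn => /orP[/Udisj ->//|/Udisj]; rewrite setIC => ->.
Qed.

(** * Strong duals with a G-base *)

(** The pull-back of a product metric under evaluation at the [x n]: the caps leave finitely many
    coordinates relevant at each scale, which makes it continuous on [Ck X]. *)
Definition seqdist (X : topologicalType) (x : nat -> X) (f g : Ck X) : RR :=
  sup (range (fun n => Num.min `|Ck_val f (x n) - Ck_val g (x n)| n.+1%:R^-1)).

Section SeqDist.
Context {X : topologicalType} (x : nat -> X).

Lemma seqdist_ge (f g : Ck X) n :
  Num.min `|Ck_val f (x n) - Ck_val g (x n)| n.+1%:R^-1 <= seqdist x f g.
Proof.
apply: ub_le_sup; last by exists n.
exists 1 => _ [m _ <-]; rewrite ge_min; apply/orP; right.
by rewrite invf_le1 ?ltr0n// ler1n.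
Qed.

Lemma seqdist_le (f g : Ck X) (M : RR) :
  (forall n, Num.min `|Ck_val f (x n) - Ck_val g (x n)| n.+1%:R^-1 <= M) ->
  seqdist x f g <= M.
Proof.
by move=> h; apply: ge_sup; [eexists; exists 0%N|move=> _ [n _ <-]; exact: h].
Qed.

Lemma seqdist_pseudometric : pseudometric (seqdist x).
Proof.
have inv0 n : 0 <= n.+1%:R^-1 :> RR by rewrite invr_ge0.
have ge0 f g : 0 <= seqdist x f g.
  by apply: le_trans (seqdist_ge f g 0%N); rewrite le_min normr_ge0 inv0.
split=> [f|f g|f g h].
- apply/eqP; rewrite eq_le ge0 andbT; apply: seqdist_le => n.
  by rewrite subrr normr0 ge_min lexx.
- by apply/eqP; rewrite eq_le; apply/andP; split; apply: seqdist_le => n;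
    rewrite distrC; exact: seqdist_ge.
- apply: seqdist_le => n.
  apply: le_trans (lerD (seqdist_ge f g n) (seqdist_ge g h n)).
  have : `|Ck_val f (x n) - Ck_val h (x n)| <=
      `|Ck_val f (x n) - Ck_val g (x n)| + `|Ck_val g (x n) - Ck_val h (x n)|.
    by apply: le_trans (ler_normD _ _); rewrite addrA subrK.
  move: (inv0 n) (normr_ge0 (Ck_val f (x n) - Ck_val g (x n)))
    (normr_ge0 (Ck_val g (x n) - Ck_val h (x n))).
  move: (n.+1%:R^-1 : RR) `|_| `|_| `|_| => i a b c i0 b0 c0 abc.
  by rewrite ge_min; have [bi|ib] := leP b i; have [ci|ic] := leP c i;
    apply/orP; (left; lra) || (right; lra).
Qed.

Lemma dcont_seqdist_continuous (F : Ck X -> RR) :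
  dcont (seqdist x) F -> continuous F.
Proof.
move=> cF; apply/continuousRP => f e e0.
have FF := dist_nbhs_filter (seqdist x) f.
have /cvgRP/(_ e e0)[r r0 rP] := cF f.
have [N rN] := archiR (r / 2)^-1.
apply/Ck_nbhsP; exists (x @` [set n | (n < N)%N]), (r / 2); split; last first.
- move=> g gf; apply: rP => /=; suff : seqdist x f g <= r / 2 by lra.
  apply: seqdist_le => n; rewrite ge_min; have [nN|Nn] := ltnP n N.
    by apply/orP; left; rewrite distrC ltW// gf//; exists n.
  apply/orP; right; rewrite invf_ple ?posrE ?ltr0n//; last by lra.
  by apply/ltW; apply: lt_le_trans rN _; rewrite ler_nat ltnW.
- by lra.
- by apply: finite_compact; apply: finite_image; exact: finite_II.
Qed.

Lemma seqdist_eval_dcont n : dcont (seqdist x) (fun f => `|Ck_val f (x n)|).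
Proof.
move=> f; have FF := dist_nbhs_filter (seqdist x) f.
apply: cvgR_norm; apply/cvgRP => e e0.
have i0 : 0 < n.+1%:R^-1 :> RR by rewrite invr_gt0 ltr0n.
exists (Num.min e n.+1%:R^-1); first by rewrite lt_min e0.
move=> g /=; rewrite lt_min distrC => /andP[h1 h2].
have := seqdist_ge f g n; rewrite ge_min => /orP[h|h]; first exact: le_lt_trans h1.
by have := le_lt_trans h h2; rewrite ltxx.
Qed.

End SeqDist.

(** Along points [x n] where [|f|] is at least [n], members of [Q n] have values at [x n] bounded by
    some [M n]. A locally finite sum of bumps of height [M n + 1] at [x n] is continuous and lies in
    no [Q n]. *)
Lemma strong_Gbase_pseudocompact (X : topologicalType) :
  strong_dual_has_Gbase (@CkCk_val X) -> functionally_bounded [set: X].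
Proof.
move=> /(@strong_Gbase_dominating (Ck X))[g [gmono gdom]] f cf; apply: contrapT => unb.
pose fn (y : X) : RR := `|f y|; have cn : continuous fn by exact: continuousR_abs.
have [x [_ kx]] := @unbounded_seq X setT fn unb.
have pd := seqdist_pseudometric x.
have [h ch _|Q [Qb Qc]] := dominated_cover pd gmono _ (Ckm (@continuousR_cst X 0)).
  by apply: gdom; exact: dcont_seqdist_continuous ch.
have /choice[M MP] n : exists M : RR, 0 <= M /\ forall q, Q n q -> `|Ck_val q (x n)| <= M.
  have [M MP] := Qb n _ (@seqdist_eval_dcont _ x n).
  exists `|M|; split => // q /MP h; exact: le_trans h (ler_norm _).
pose u n y := (M n + 1) * Num.max 0 (1 - 2 * `|fn y + (- fn (x n))|).
have uc n : continuous (u n).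
  apply: continuousR_scale; apply: continuousR_bump; apply: continuousR_abs; apply: continuousR_add => //.
  exact: continuousR_cst.
have M0 n : 0 <= M n by case: (MP n).
have u0 n y : 0 <= u n y by rewrite mulr_ge0// ?le_max ?lexx// addr_ge0.
have uloc (t : X) : exists N, nbhs t [set s | forall n, (N <= n)%N -> u n s = 0].
  apply: (@level_locfin _ _ _ fn (fun k => fn (x k))) => //; first exact: cn.
  by move=> k s h1; rewrite /u max_l ?mulr0//; lra.
have [m Qm] := Qc (Ckm (lfsum_continuous uc uloc)).
have [_ /(_ _ Qm)] := MP m; rewrite Ckm_val => h.
have : u m (x m) <= lfsum u (x m) by exact: lfsum_nbhs_ge.
rewrite /u subrr normr0 mulr0 subr0 max_r// mulr1.
by have := ler_norm (lfsum u (x m)); lra.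
Qed.

(** The discrete sequence is cut into infinitely many infinite blocks. On block [n] consider the
    patterns equal to [c n] at one position and 0 elsewhere: [Q n] misses one of them, as otherwise
    it would contain a [c n]-separated sequence. A uniformly convergent series realizes the missed
    pattern on every block. *)
Lemma strong_Gbase_compact_finite (X : topologicalType) :
  tychonoff_space X -> compact [set: X] ->
  strong_dual_has_Gbase (@CkCk_val X) -> finite_set [set: X].
Proof.
move=> tyX cX /(@strong_Gbase_dominating (Ck X))[g [gmono gdom]].
apply: contrapT => infX.
have pd := cdist_pseudometric cX.
have [h ch _|Q [Qb Qc]] := dominated_cover pd gmono _ (Ckm (@continuousR_cst X 0)).
  by apply: gdom; exact: dcont_cdist_continuous ch.
have [x [e [ce e01 ex ex0]]] := infinite_discrete_bumps tyX infX.
pose c (n : nat) : RR := 2^-1 ^+ n.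
have c0 n : 0 < c n by rewrite exprn_gt0// invr_gt0.
have cS n : c n.+1 = c n / 2 by rewrite /c exprSr.
pose i (n k : nat) := pickle (n, k).
have inj_i n k n' k' : i n k = i n' k' -> n = n' /\ k = k'.
  by move=> /(pcan_inj (@pickleK _))[].
have /choice[kap kapP] n : exists k, forall q, Q n q -> Ck_val q (x (i n k)) = c n ->
    (forall j, j != k -> Ck_val q (x (i n j)) = 0) -> False.
  apply: contrapT => nk.
  have /choice[q qP] k : exists q, [/\ Q n q, Ck_val q (x (i n k)) = c n &
      forall j, j != k -> Ck_val q (x (i n j)) = 0].
    by apply: contrapT => nq; apply: nk; exists k => q Qq q1 q2; apply: nq; exists q.
  have [||f cf [f0 fq]] := separated_unbounded pd (q := q) (c := fun k => k%:R) (c0 n).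
  - move=> j k jk; have [_ qj _] := qP j; have [_ _ qk] := qP k.
    apply: le_trans (cdist_ge cX (q j) (q k) (x := x (i n j)) I).
    by rewrite qj qk// subr0 ler_norm.
  - by [].
  have [M MP] := Qb n _ cf; have [N MN] := archiR M.
  have [QN _ _] := qP N; have := MP _ QN; have := fq N; lra.
pose p n y := \sum_(j < n) c j * e (i j (kap j)) y.
have pS n y : p n.+1 y = p n y + c n * e (i n (kap n)) y by rewrite /p big_ord_recr.
have cp n : continuous (p n).
  elim: n => [|n IH].
    rewrite (_ : p 0%N = fun _ => 0); first exact: continuousR_cst.
    by apply/funext => y; rewrite /p big_ord0.
  rewrite (_ : p n.+1 = fun y => p n y + c n * e (i n (kap n)) y).
    by apply: continuousR_add => //; exact: continuousR_scale.
  by apply/funext => y; exact: pS.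
(* The tail from term [n] on is at most the sum of the [c j] with [j >= n], which is [2 * c n]. *)
have [f fp] : exists f, forall n y, `|f y - p n y| <= 2 * c n * 1.
  apply: nested_limit => [n y|n y]; first by rewrite !mulr_ge0// ltW.
  rewrite pS addrAC subrr add0r cS !mulr1.
  have /andP[e0 e1] := e01 (i n (kap n)) y.
  by rewrite ger0_norm ?mulr_ge0 ?(ltW (c0 n))//; have := c0 n; nra.
have csmall (r : RR) : 0 < r -> forall N, exists2 n, (N <= n)%N & 2 * c n < r.
  move=> r0 N; have [m rm] := archiR (2 / r).
  have cm n : c n * n.+1%:R <= 1.
    elim: n => [|n IH]; first by rewrite /c expr0 mul1r.
    apply: le_trans IH; rewrite cS; have := c0 n.
    have : 1 <= n.+1%:R :> RR by rewrite ler1n.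
    rewrite -[n.+2%:R]natr1; nra.
  exists (maxn N m); first exact: leq_maxl.
  have := cm (maxn N m); have := c0 (maxn N m).
  have : m%:R <= (maxn N m).+1%:R :> RR by rewrite ler_nat leqW// leq_maxr.
  move: rm; rewrite ltr_pdivrMr//; move: (m%:R : RR) ((maxn N m).+1%:R : RR) (c _) => a b C h1 h2 h3 h4.
  have := ler_wpM2l (ltW h3) h2; rewrite -(ltr_pM2l h3) in h1 => h5.
  by have := ler_wpM2r (ltW r0) (le_trans h5 h4); lra.
have cf : continuous f.
  apply: (weighted_limit_continuous (p := p) (c := fun n => 2 * c n) (w := fun=> 1)) => //.
    exact: continuousR_cst.
  by move=> r r0; have [n _] := csmall r r0 0%N; exists n.
have fx m j : f (x (i m j)) = if j == kap m then c m else 0.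
  have px n : (m < n)%N -> p n (x (i m j)) = if j == kap m then c m else 0.
    move=> mn; rewrite /p (bigD1 (Ordinal mn))//= big1 ?addr0.
      case: eqP => [->|jk]; first by rewrite ex mulr1.
      by rewrite ex0 ?mulr0//; apply/eqP => /inj_i[].
    move=> n' nm; rewrite ex0 ?mulr0//; apply/eqP => /inj_i[mn' _].
    by move/eqP: nm; apply; apply: val_inj.
  apply/eqP; rewrite -subr_eq0 -normr_eq0 eq_le normr_ge0 andbT.
  rewrite leNgt; apply/negP => r0.
  have [n mn cn] := csmall _ r0 m.+1.
  by have := fp n (x (i m j)); rewrite (px n mn); lra.
have [m Qm] := Qc (Ckm cf).
apply: (kapP m _ Qm); first by rewrite Ckm_val fx eqxx.
by move=> j jk; rewrite Ckm_val fx (negbTE jk).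
Qed.

(** * Lindeloef property and sigma-compactness from a G-base *)

Lemma net_lindelof (X : topologicalType) (d : X -> X -> RR) :
  metrizes d ->
  (forall e : RR, 0 < e -> exists q : nat -> X, forall x, exists k, d (q k) x < e) ->
  lindelof_space X.
Proof.
move=> [[d0 dC dT] dN] nets V Vx.
have inv_gt0 m : 0 < m.+1%:R^-1 :> RR by rewrite invr_gt0 ltr0n.
have /choice[q qP] (m : nat) := nets _ (inv_gt0 m).
(* For each of the countably many balls that fits into some [V y], one such [y] is kept. *)
have /choice[c cP] (mk : nat * nat) : exists x, forall y,
    [set z | d (q mk.1 mk.2) z < mk.1.+1%:R^-1] `<=` V y ->
    [set z | d (q mk.1 mk.2) z < mk.1.+1%:R^-1] `<=` V x.
  have [[x xP]|nx] := pselect (exists x, [set z | d (q mk.1 mk.2) z < mk.1.+1%:R^-1] `<=` V x).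
    by exists x.
  by exists (q 0%N 0%N) => y yV; case: nx; exists y.
exists (fun n => if @unpickle (nat * nat)%type n is Some mk then c mk else q 0%N 0%N).
move=> y; have /dN[r r0 rV] := Vx y.
have [m rm] := archiR (r / 2)^-1; have [k yk] := qP m y.
exists (pickle (m, k)); rewrite pickleK; apply: (cP (m, k) y) => //= z /= zk.
apply: rV => /=; have := dT y (q m k) z; rewrite (dC y (q m k)).
have : m.+1%:R^-1 <= r / 2.
  rewrite invf_ple ?posrE ?ltr0n//; last by lra.
  by apply/ltW; apply: lt_trans rm _; rewrite ltr_nat.
by move: zk yk; move: (m.+1%:R^-1 : RR) => i; lra.
Qed.

Lemma closure_functionally_bounded (X : topologicalType) (A : set X) :
  functionally_bounded A -> functionally_bounded (closure A).
Proof.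
move=> fbA f cf; have [M MP] := fbA f cf; exists M => x clx.
rewrite leNgt; apply/negP => Mx.
have /continuousRP/(_ x (`|f x| - M)) := continuousR_abs cf.
rewrite subr_gt0 => /(_ Mx) /clx[y [/MP h]] /=.
by rewrite ltr_norml => /andP[]; lra.
Qed.

Lemma metrizable_Gbase_lindelof (X : topologicalType) (x0 : X) :
  metrizable X -> has_Gbase (@CkCk_val X) -> lindelof_space X.
Proof.
move=> /metrizableP[d dX] /CkCk_Gbase_dominating[g [gmono gdom]].
apply: (net_lindelof dX) => e e0; have [pd _] := dX.
apply: (dominated_net pd gmono _ x0 e0) => f cf _.
by apply: gdom; apply/(metrizes_dcont f dX).
Qed.

Lemma metrizable_Gbase_sigma_compact (X : topologicalType) :
  tychonoff_space X -> metrizable X -> has_Gbase (@CkCk_val X) -> sigma_compact X.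
Proof.
move=> tyX mX GX; have [[x0]|nX] := pselect (inhabited X); last first.
  exists (fun _ => set0); split; first by move=> _; exact: compact0.
  by apply/seteqP; split => // x _; case: nX.
have liX := metrizable_Gbase_lindelof x0 mX GX.
have [d dX] := metrizableP mX; have [pd _] := dX.
have [g [gmono gdom]] := CkCk_Gbase_dominating GX.
have [f cf _|Q [Qb Qc]] := dominated_cover pd gmono _ x0.
  by apply: gdom; apply/(metrizes_dcont f dX).
exists (fun n => closure (Q n)); split.
  move=> n; apply: lindelof_bounded_compact => //; first exact: closed_closure.
  apply: closure_functionally_bounded => f cf.
  by apply: Qb; apply/(metrizes_dcont _ dX); exact: continuousR_abs.
apply/seteqP; split => // x _; have [n Qx] := Qc x.
by exists n => //; exact: subset_closure.
Qed.

(** * Constructions of G-bases *)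

Lemma fcr_has_Gbase (Y : topologicalType) : has_fcr Y -> has_Gbase (@Ck_val Y).
Proof.
move=> [K [cK [_ [Kmono Kcof]]]].
exists (fun a => [set f | forall y, K a y -> `|Ck_val f y| < (a 0%N).+1%:R^-1]); split; last split.
- move=> a; exists (Ckm (@continuousR_cst Y 0)); split => //.
  apply/Ck_nbhsP; exists (K a), (a 0%N).+1%:R^-1; split => //.
  by move=> f h y /h; rewrite Ckm_val subr0.
- move=> U /nbhs0_CkP[C [e [cC e0 CU]]]; have [a Ca] := Kcof _ cC.
  have [n en] := archiR e^-1.
  pose b i := if i is 0%N then maxn (a 0%N) n else a i.
  have ab : leNN a b by move=> [|i] /=; rewrite ?leq_maxl.
  exists b => f fb; apply: CU => y /Ca/(Kmono _ _ ab)/fb h.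
  apply: lt_le_trans h _; rewrite invf_ple ?posrE ?ltr0n//; apply: le_trans (ltW en) _.
  by rewrite ler_nat /b leqW// leq_maxr.
- move=> a b ba f fa y /(Kmono _ _ ba)/fa h; apply: lt_le_trans h _.
  by rewrite lef_pV2 ?posrE ?ltr0n// ler_nat ltnS; exact: ba.
Qed.

Lemma natR_ge (x : RR) : exists n : nat, x <= n%:R.
Proof. by have [n /ltW] := archiR x; exists n. Qed.

Lemma compact_functionally_bounded (X : topologicalType) (C : set X) :
  compact C -> functionally_bounded C.
Proof. by move=> cC f cf; exact: continuous_bounded_compact. Qed.

(** One number [a (pickle (n, m))] both bounds [f] on [Z n] and fixes the radius for oscillation
    1/(m+1) there; both conditions weaken as [a] grows. *)
Lemma sigma_compact_Ck_fcr (X : topologicalType) :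
  metrizable X -> sigma_compact X -> has_fcr (Ck X).
Proof.
move=> mX [Z [cZ ZX]]; have [d dX] := metrizableP mX.
pose R (a : nat -> nat) (n m : nat) : set (Ck X) :=
  [set f | forall x, Z n x -> `|Ck_val f x| <= (a (pickle (n, m)))%:R /\
    forall y, d x y < (a (pickle (n, m))).+1%:R^-1 ->
      `|Ck_val f y - Ck_val f x| <= m.+1%:R^-1].
pose K a : set (Ck X) := [set f | forall n m, R a n m f].
have inv_gt0 m : 0 < m.+1%:R^-1 :> RR by rewrite invr_gt0 ltr0n.
have Kcof C : compact C -> exists a, C `<=` K a.
  move=> /compact_functionally_bounded fbC.
  have /choice[r rP] (nm : nat * nat) : exists r : RR, 0 < r /\
      forall f x y, C f -> Z nm.1 x -> d x y < r -> `|Ck_val f y - Ck_val f x| <= nm.2.+1%:R^-1.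
    have [r r0 rP] := bounded_uniformly_equicontinuous dX fbC (cZ nm.1) (inv_gt0 nm.2).
    by exists r.
  have /choice[M MP] (n : nat) : exists M : RR, forall f x, C f -> Z n x -> `|Ck_val f x| <= M.
    (* The distance to the zero function on [Z n] is continuous on [Ck X], hence bounded on [C]. *)
    have [M MP] := fbC _ (dcont_cdist_continuous (cZ n)
      (@dcont_dist (Ck X) _ (cdist_pseudometric (cZ n)) (Ckm (@continuousR_cst X 0)))).
    exists M => f x Cf Zx; apply: le_trans (MP f Cf); apply: le_trans (ler_norm _).
    by have := cdist_ge (cZ n) (Ckm (@continuousR_cst X 0)) f Zx; rewrite Ckm_val sub0r normrN.
  have /choice[N NP] (nm : nat * nat) : exists N : nat, M nm.1 <= N%:R /\ N.+1%:R^-1 < r nm.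
    have [r0 _] := rP nm; have [N NP] := archiR (Num.max (M nm.1) (r nm)^-1).
    exists N; move: NP; rewrite gt_max => /andP[h1 h2]; split; first exact: ltW.
    by rewrite invf_plt ?posrE ?ltr0n//; apply: lt_trans h2 _; rewrite ltr_nat.
  exists (fun i => if @unpickle (nat * nat)%type i is Some nm then N nm else 0%N).
  move=> f Cf n m x Zx; rewrite pickleK; have [h1 h2] := NP (n, m).
  split; first by apply: le_trans h1; exact: MP.
  by move=> y xy; have [_] := rP (n, m); apply => //; exact: lt_trans h2.
exists K; split; last split; last split.
- move=> a; apply: Ck_ascoli.
  + move=> f clf n m x Zx.
    have near_f y (e : RR) : 0 < e -> exists g, [/\ K a g, `|Ck_val g x - Ck_val f x| < e &
        `|Ck_val g y - Ck_val f y| < e].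
      move=> e0; have [|g [Kg gf]] := clf [set g | `|Ck_val g x - Ck_val f x| < e /\
          `|Ck_val g y - Ck_val f y| < e].
        apply/Ck_nbhsP; exists ([set x] `|` [set y]), e; split => //.
          by apply: compactU; exact: compact_set1.
        by move=> g h; split; apply: h; [left|right].
      by exists g; case: gf.
    split.
      apply/ler_addgt0Pr => e e0; have [g [Kg gx _]] := near_f x e e0.
      have [h _] := Kg n m x Zx; have := ler_normD (Ck_val f x - Ck_val g x) (Ck_val g x).
      by rewrite subrK (distrC (Ck_val f x)); lra.
    move=> y xy; apply/ler_addgt0Pr => e e0.
    have [|g [Kg gx gy]] := near_f y (e / 2); first by lra.
    have [_ /(_ _ xy) h] := Kg n m x Zx.
    rewrite (_ : _ - _ = (Ck_val f y - Ck_val g y) + (Ck_val g x - Ck_val f x)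
       + (Ck_val g y - Ck_val g x)); last by ring.
    apply: le_trans (ler_normD _ _) _.
    have := ler_normD (Ck_val f y - Ck_val g y) (Ck_val g x - Ck_val f x).
    move: h gx gy; rewrite (distrC (Ck_val g y) (Ck_val f y)).
    by move: (m.+1%:R^-1 : RR) => i; lra.
  + move=> x; have : [set: X] x by []; rewrite -ZX => -[n _ Zx].
    by exists (a (pickle (n, 0%N)))%:R => f /(_ n 0%N x Zx)[].
  + move=> x e e0; have : [set: X] x by []; rewrite -ZX => -[n _ Zx].
    have [m em] := archiR e^-1.
    exists [set y | d x y < (a (pickle (n, m))).+1%:R^-1].
      by have [_ dN] := dX; apply/dN; exact: dist_nbhs_ball.
    move=> f y /(_ n m x Zx)[_ h] /h{}h; apply: le_trans h _.
    rewrite invf_ple ?posrE ?ltr0n//; apply: le_trans (ltW em) _.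
    by rewrite ler_nat.
- apply/seteqP; split => // f _; have [a fa] := Kcof _ (@compact_set1 _ f).
  by exists a => //; exact: fa.
- move=> a b ab f fa n m x /(fa n m)[h1 h2]; have abnm := ab (pickle (n, m)).
  split; first by apply: le_trans h1 _; rewrite ler_nat.
  move=> y xy; apply: h2; apply: lt_le_trans xy _.
  by rewrite lef_pV2 ?posrE ?ltr0n// ler_nat ltnS.
- exact: Kcof.
Qed.

(** Bounded sets of [Ck Y] are those uniformly bounded on each [K m], so sequences of integer bounds
    index a cofinal family. The case in view is [Y = Ck X] with [X] finite. *)
Lemma hemicompact_strong_Gbase (Y : topologicalType) (K : nat -> set Y) :
  (forall m, compact (K m)) -> (forall C, compact C -> exists m, C `<=` K m) ->
  strong_dual_has_Gbase (@Ck_val Y).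
Proof.
move=> cK Kcof.
apply: (@bounded_resolution_strong_Gbase Y (Ck Y) _
  (fun a => [set f | forall m y, K m y -> `|Ck_val f y| <= (a m)%:R])).
- move=> a U /nbhs0_CkP[C [e [cC e0 CU]]]; have [m Cm] := Kcof _ cC.
  exists (e / 2 / (a m).+1%:R); first by rewrite !divr_gt0// ltr0n.
  move=> t f g tr fa gt; apply: CU => y /Cm Ky; rewrite gt normrM.
  apply: le_lt_trans (_ : e / 2 < e); last by lra.
  have -> : e / 2 = e / 2 / (a m).+1%:R * (a m).+1%:R by rewrite divfK ?gt_eqF// ltr0n.
  apply: ler_pM => //; apply: le_trans (fa _ _ Ky) _; by rewrite ler_nat.
- move=> a b ab f fa m y /fa h; apply: le_trans h _; rewrite ler_nat; exact: ab.
- move=> A bA.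
  have /choice[a aP] m : exists n : nat, forall f y, A f -> K m y -> `|Ck_val f y| <= n%:R.
    have [|r r0 rP] := bA [set f | forall y, K m y -> `|Ck_val f y| < 1].
      exists (Ckm (@continuousR_cst Y 0)); split => //; apply/Ck_nbhsP; exists (K m), 1.
      by split => // f h y /h; rewrite Ckm_val subr0.
    have [n rn] := natR_ge r^-1; exists n => f y Af Ky; apply: le_trans rn.
    have := rP r f (Ckm (continuousR_scale (c := r) (@Ck_cont _ f))) _ Af _ y Ky.
    rewrite Ckm_val normrM ger0_norm ?(ltW r0)// => h.
    rewrite -[X in _ <= X]mul1r ler_pdivlMr// mulrC ltW// h//.
  by exists a => f Af m y; exact: aP.
Qed.

Lemma finite_nbhs_set1 (X : topologicalType) (x : X) :
  hausdorff_space X -> finite_set [set: X] -> nbhs x [set x].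
Proof.
move=> hX fX; apply: open_nbhs_nbhs; split => //.
rewrite -[[set x]]setCK; apply: closed_openC.
have : finite_set (~` [set x]) by apply: sub_finite_set fX.
move: (~` [set x]); apply/accessible_finite_set_closed; exact: hausdorff_accessible.
Qed.

Lemma finite_Ck_strong_Gbase (X : topologicalType) :
  hausdorff_space X -> finite_set [set: X] -> strong_dual_has_Gbase (@CkCk_val X).
Proof.
move=> hX fX.
apply: (@hemicompact_strong_Gbase (Ck X) (fun m => [set f | forall x, `|Ck_val f x| <= m%:R])).
- move=> m; apply: Ck_ascoli => [f clf x|x|x e e0].
  + apply/ler_addgt0Pr => e e0.
    have [|g [gm /= gf]] := clf [set g | `|Ck_val g x - Ck_val f x| < e].
      by apply: (continuousRP _).1 => //; exact: Ck_eval_continuous.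
    have := gm x; have := ler_normD (Ck_val f x - Ck_val g x) (Ck_val g x).
    by rewrite subrK (distrC (Ck_val f x)); lra.
  + by exists m%:R => f; apply.
  + exists [set x]; first exact: finite_nbhs_set1.
    by move=> f y _ ->; rewrite subrr normr0 ltW.
- move=> C cC; have /finite_seqP[s sX] := fX.
  have [M MP] : exists M : RR, forall x f, x \in s -> C f -> `|Ck_val f x| <= M.
    elim: s {sX} => [|x s [M MP]]; first by exists 0.
    have [N NP] := continuous_bounded_compact cC (@Ck_eval_continuous X x).
    exists (Num.max M N) => y f; rewrite inE le_max => /predU1P[->|ys] Cf.
      by rewrite NP ?orbT.
    by rewrite MP.
  have [m Mm] := natR_ge M; exists m => f Cf x; apply: le_trans Mm; apply: MP => //.
  by have : [set: X] x by []; rewrite sX.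
Qed.

(** Coordinate 0 of [a] bounds the step [n], and the coordinates shifted by one bound the seminorms
    [p n k]. Regularity makes these sets cofinal among the bounded ones. *)
Lemma regular_LM_strong_Gbase (T : Type) (V : topologicalType) (v : V -> T -> RR) :
  regular_LM_space v -> strong_dual_has_Gbase v.
Proof.
move=> [En [p [Elin [_ [_ [psn [_ [_ [_ [nbhsP Breg]]]]]]]]]].
pose B1 (a : nat -> nat) n : set V :=
  [set x | En n x /\ forall k, p n k x <= (a (pickle (n, k)).+1)%:R].
have B1b a n : tvs_bounded v (B1 a n).
  move=> U /nbhsP[W [convW WU] Wn].
  have [k [e e0 eW]] := Wn n.
  pose M : RR := (a (pickle (n, k)).+1).+1%:R.
  have M0 : 0 < M by rewrite ltr0n.
  exists (e / 2 / M); first by rewrite !divr_gt0.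
  move=> t x z tr [Ex px] zt; apply: WU; apply: eW; split.
    by have [_ h] := Elin n; apply: (h t 0 x x) => // s; rewrite zt mul0r addr0.
  have [p0 [pZ _]] := psn n k; rewrite (pZ _ _ _ Ex zt).
  apply: le_lt_trans (_ : e / 2 < e); last by lra.
  have -> : e / 2 = e / 2 / M * M by rewrite divfK ?gt_eqF.
  apply: ler_pM => //; first exact: p0.
  by apply: le_trans (px k) _; rewrite ler_nat.
(* The union over [n <= a 0] makes the family increasing, as bounds at one step say nothing about
   [B1 a] at another; it is finite, so it stays bounded. *)
apply: (@bounded_resolution_strong_Gbase T V v
  (fun a => [set x | exists2 n, (n <= a 0%N)%N & B1 a n x])).
- move=> a U /B1b h; elim: (a 0%N) => [|N [r r0 rP]].
    have [r r0 rP] := h a 0%N; exists r => // t x z tr [n].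
    by rewrite leqn0 => /eqP -> ; exact: rP.
  have [r' r'0 rP'] := h a N.+1.
  exists (Num.min r r'); first by rewrite lt_min r0.
  move=> t x z; rewrite le_min => /andP[tr tr'] [n nN Bx] zt.
  move: nN; rewrite leq_eqVlt => /predU1P[nN|nN]; last by apply: (rP t x) => //; exists n.
  by apply: (rP' t x) => //; rewrite -nN.
- move=> a b ab x [n na [Ex px]]; exists n; first exact: leq_trans (ab 0%N).
  by split => // k; apply: le_trans (px k) _; rewrite ler_nat; exact: ab.
- move=> A /Breg[n [AE Ap]].
  have /choice[N NP] k : exists N : nat, forall x, A x -> p n k x <= N%:R.
    have [M MP] := Ap k; have [N MN] := natR_ge M; exists N => x /MP h.
    exact: le_trans MN.
  exists (fun i => if i is i'.+1 then
     (if @unpickle (nat * nat)%type i' is Some nk then N nk.2 else 0%N) else n).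
  move=> x Ax; exists n => //; split; first exact: AE.
  by move=> k; rewrite pickleK; exact: NP.
Qed.

(** * Finiteness of X from a G-base of the strong dual *)

Lemma aleph0_lindelof (X : topologicalType) (x0 : X) :
  aleph0_space X -> lindelof_space X.
Proof.
move=> [_ [M [f [/metrizableP[d dM] [[D [cD clD]] [cf [fX _]]]]]]].
have surj x : exists m, f m = x.
  by have : [set: X] x by []; rewrite -fX => -[m _ <-]; exists m.
have [m0 _] := surj x0.
have [/countable_injP[i iinj] [[d0 dC dT] dN]] := (cD, dM).
have liM : lindelof_space M.
  apply: (net_lindelof dM) => e e0.
  exists (fun n => xget m0 [set p | D p /\ i p = n]) => m.
  have : closure D m by rewrite clD.
  move=> /(_ [set y | d m y < e])[|p [Dp mp]]; first by apply/dN; exact: dist_nbhs_ball.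
  exists (i p); rewrite dC; case: xgetP => [q _ [Dq iq]|/(_ p) np]; last by case: np.
  by rewrite (iinj _ _ _ _ iq) ?inE.
move=> V Vx; have [|s sP] := liM (fun m => f @^-1` V (f m)).
  by move=> m; apply: cf; exact: Vx.
exists (f \o s) => y; have [m <-] := surj y; have [k h] := sP m.
by exists k.
Qed.

Lemma pseudocompact_strong_Gbase_finite (X : topologicalType) :
  tychonoff_space X ->
  (functionally_bounded [set: X] -> compact [set: X]) ->
  strong_dual_has_Gbase (@CkCk_val X) -> finite_set [set: X].
Proof.
move=> tyX pcX GX; apply: strong_Gbase_compact_finite => //; apply: pcX.
exact: strong_Gbase_pseudocompact.
Qed.

(** The Lindeloef property is asked under an inhabitant of [X], which an infinite [X] supplies. *)
Lemma lindelof_strong_Gbase_finite (X : topologicalType) :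
  tychonoff_space X -> (X -> lindelof_space X) ->
  strong_dual_has_Gbase (@CkCk_val X) -> finite_set [set: X].
Proof.
move=> tyX liX GX; apply: contrapT => /[dup] infX /infinite_setN0[x _]; apply: infX.
apply: pseudocompact_strong_Gbase_finite => // fbX.
by apply: lindelof_bounded_compact => //; exact: liX.
Qed.

Lemma mu_strong_Gbase_finite (X : topologicalType) :
  mu_space X -> strong_dual_has_Gbase (@CkCk_val X) -> finite_set [set: X].
Proof.
move=> [tyX muX]; apply: pseudocompact_strong_Gbase_finite => // /muX.
by rewrite closureT.
Qed.

Lemma finite_fcr (X : topologicalType) : finite_set [set: X] -> has_fcr X.
Proof.
move=> fX; exists (fun _ => setT); split; last split; last split.
- by move=> _; exact: finite_compact.
- by apply/seteqP; split => // x _; exists (fun _ => 0%N).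
- by [].
- by move=> C _; exists (fun _ => 0%N).
Qed.

(** * The discrete space of natural numbers, for the failure of the converse *)

Lemma nat_continuous (f : nat -> RR) : continuous f.
Proof. by move=> n A /nbhs_singleton fA; apply/principal_filterP. Qed.

Lemma nat_tychonoff : tychonoff_space nat.
Proof.
split; first exact: order_hausdorff.
move=> B x _ nBx; exists (fun y => if y == x then 0 else 1); split.
  exact: nat_continuous.
split; first by rewrite eqxx.
by move=> y By; case: eqP => // yx; case: nBx; rewrite -yx.
Qed.

Lemma nat_bounded_finite (A : set nat) : functionally_bounded A ->
  exists n, A `<=` [set i | (i <= n)%N].
Proof.
move=> /(_ _ (@nat_continuous (fun n => n%:R)))[M MP].
have [n Mn] := natR_ge M; exists n => i /MP; rewrite ger0_norm// => h.
by rewrite /= -(ler_nat RR); exact: le_trans Mn.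
Qed.

Lemma finite_le_set (n : nat) : finite_set [set i | (i <= n)%N].
Proof. exact: (finite_II n.+1). Qed.

Lemma nat_mu_space : mu_space nat.
Proof.
split; first exact: nat_tychonoff.
move=> A /nat_bounded_finite[n An]; apply: finite_compact.
rewrite -(closure_id A).1; last exact: discrete_closed.
exact: sub_finite_set An (finite_le_set n).
Qed.

Lemma nat_fcr : has_fcr nat.
Proof.
exists (fun a => [set i | (i <= a 0%N)%N]); split; last split; last split.
- by move=> a; apply: finite_compact; exact: finite_le_set.
- by apply/seteqP; split => // n _; exists (fun _ => n) => //=.
- by move=> a b ab i /= /leq_trans; apply; exact: ab.
- move=> C /compact_functionally_bounded/nat_bounded_finite[n Cn].
  by exists (fun _ => n).
Qed.

Theorem theorem3p5 :
  (* (i) *)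
  (forall X : topologicalType, tychonoff_space X -> metrizable X ->
     (has_Gbase (@CkCk_val X) <-> sigma_compact X) /\
     (has_Gbase (@CkCk_val X) -> barrelled (@CkCk_val X))) /\
  (* (ii) *)
  (forall X : topologicalType, aleph0_space X ->
     (strong_dual_has_Gbase (@CkCk_val X) <-> finite_set [set: X]) /\
     (~ finite_set [set: X] -> ~ regular_LM_space (@CkCk_val X))) /\
  (* (iii) *)
  (forall X : topologicalType, mu_space X ->
     strong_dual_has_Gbase (@CkCk_val X) ->
     has_fcr X /\ has_Gbase (@Ck_val X)) /\
  (exists X : topologicalType,
     mu_space X /\ has_fcr X /\ ~ strong_dual_has_Gbase (@CkCk_val X)) /\
  (* consequence *)
  (forall X : topologicalType, tychonoff_space X -> metrizable X -> sigma_compact X ->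
     ~ finite_set [set: X] ->
     [/\ barrelled (@CkCk_val X), has_Gbase (@CkCk_val X) &
         ~ strong_dual_has_Gbase (@CkCk_val X)]).
Proof.
have brl (X : topologicalType) : metrizable X -> barrelled (@CkCk_val X).
  move=> mX; apply: Ck_barrelled; first exact: Ck_bumps.
  by move=> A; exact: Ck_bounded_compact.
have sig (X : topologicalType) : metrizable X -> sigma_compact X -> has_Gbase (@CkCk_val X).
  by move=> mX sX; apply: fcr_has_Gbase; exact: sigma_compact_Ck_fcr.
have al (X : topologicalType) : aleph0_space X ->
    strong_dual_has_Gbase (@CkCk_val X) -> finite_set [set: X].
  move=> aX; have [tyX _] := aX; apply: lindelof_strong_Gbase_finite => // x.
  exact: aleph0_lindelof.
split=> [X tyX mX|].
  split; last by move=> _; exact: brl.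
  by split; [exact: metrizable_Gbase_sigma_compact|exact: sig].
split=> [X aX|].
  have [[hX _] _] := aX; split; last by move=> nX /regular_LM_strong_Gbase/(al _ aX).
  by split; [exact: al|exact: finite_Ck_strong_Gbase].
split=> [X muX /(mu_strong_Gbase_finite muX)/finite_fcr fX|].
  by split => //; exact: fcr_has_Gbase.
split.
  exists nat; split; first exact: nat_mu_space.
  split; first exact: nat_fcr.
  by move=> /(mu_strong_Gbase_finite nat_mu_space); exact: infinite_nat.
move=> X tyX mX sX infX; split; [exact: brl|exact: sig|].
move=> /lindelof_strong_Gbase_finite fX; apply: infX; apply: fX => // x.
by apply: metrizable_Gbase_lindelof => //; exact: sig.
Qed.
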